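(* Let $n\ge8$, let $\mathcal{C}$ be a binary $[n,k]$ self-dual code with $k=n/2$, let $\ell=\lfloor n/8\rfloor$, and let $a_0,\dots,a_\ell\in\mathbb{Q}$ (with $\sum_{r=0}^\ell a_r=1$) be the coefficients such that $f_{\mathcal{C}}(t)=2^k\sum_{r=0}^{\ell}a_r\,h(t)^r$. If for all $j\in[1:\ell-1]$ the coefficients $a_0,\dots,a_\ell$ satisfy $$\min\left\{\alpha_j=\sum_{r\in[j:\ell]}\frac{r!}{(r-j)!}\,a_r\Bigl(\frac34\Bigr)^{r-j},\ \beta_j=\sum_{r\in[j:\ell]}\frac{r!}{(r-j)!}\,a_r\right\}>0,$$ then $f_{\mathcal{C}}$ is U-shaped on $[0,1]$ around $1/\sqrt2$. Consequently, $\Delta_{\Lambda_{\mathrm A}(\mathcal{C})}(\tau)\le1$ for all $\tau>0$ (equivalently $\Theta_{\Lambda_{\mathrm A}(\mathcal{C})}(i\tau)\le\Theta_{\mathbb{Z}^n}(i\tau)$ for all $\tau>0$), and $\Delta_{\Lambda_{\mathrm A}(\mathcal{C})}$ achieves its global minimum over $\tau>0$ at $\tau=1$, i.e. $\arg\min_{\tau>0}\Delta_{\Lambda_{\mathrm A}(\mathcal{C})}(\tau)=1$.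
   Context: For integers $a\le b$, $[a:b]=\{a,a+1,\dots,b\}$. A binary $[n,k]$ code is a $k$-dimensional linear subspace $\mathcal{C}\subseteq\mathbb{F}_2^n$; it is self-dual if $\mathcal{C}=\mathcal{C}^\perp$ with respect to the standard inner product modulo $2$. Its weight enumerator is $W_{\mathcal{C}}(x,y)=\sum_{c\in\mathcal{C}}x^{n-w_{\mathrm H}(c)}y^{w_{\mathrm H}(c)}$, with $w_{\mathrm H}$ the Hamming weight. The Construction A lattice is $\Lambda_{\mathrm A}(\mathcal{C})=\frac1{\sqrt2}(\mathcal{C}+2\mathbb{Z}^n)$, codewords being viewed as $0/1$ integer vectors; it is unimodular (integral and equal to its dual, hence of volume $1$) when $\mathcal{C}$ is self-dual. For a lattice $\Lambda$ and $\tau>0$, $\Theta_\Lambda(i\tau)=\sum_{\lambda\in\Lambda}e^{-\pi\tau\|\lambda\|^2}$; the theta series ratio of a volume-one lattice is $\Delta_\Lambda(\tau)=\Theta_\Lambda(i\tau)/\Theta_{\mathbb{Z}^n}(i\tau)$. The Jacobi theta functions are $\vartheta_3(i\tau)=\sum_{v\in\mathbb{Z}}e^{-\pi\tau v^2}$ and $\vartheta_4(i\tau)=\sum_{v\in\mathbb{Z}}(-1)^v e^{-\pi\tau v^2}$; put $t(\tau)=\vartheta_4^2(i\tau)/\vartheta_3^2(i\tau)\in[0,1]$. Let $h(t)=t^4-t^2+1$ and $f_{\mathcal{C}}(t)=W_{\mathcal{C}}(\sqrt{1+t},\sqrt{1-t})$ for $t\in[0,1]$. Known facts: for a binary self-dual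 code, $\Delta_{\Lambda_{\mathrm A}(\mathcal{C})}(\tau)=2^{-k}f_{\mathcal{C}}(t(\tau))$, and there are rational $a_0,\dots,a_\ell$, $\ell=\lfloor n/8\rfloor$, with $\sum_{r=0}^\ell a_r=1$ and $f_{\mathcal{C}}(t)=2^k\sum_{r=0}^\ell a_rh(t)^r$. For any given $t\in(0,1)$ there is a unique $\tau>0$ with $t(\tau)=t$, and $t(1)=1/\sqrt2$. A function $f$ is U-shaped on an interval $[a,b]\subseteq\mathbb{R}$ around a point $t_0\in[a,b]$ if its derivative satisfies $f'(t)<0$ for $a\le t<t_0$, $f'(t_0)=0$, and $f'(t)>0$ for $t_0<t\le b$.
   Formalization: U-shapedness requires f'(t)<0 only for 0<t<1/√2, since f_C'(0)=0 always; and when ℓ=1, U-shapedness and uniqueness of the minimizer τ=1 are claimed only if a_1≠0, since a_1=0 makes f_C constant (e.g. sums of the repetition code {00,11}). *)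

(* Defs.v *)
From mathcomp Require Import all_boot all_order all_algebra.
From mathcomp Require Import all_classical all_reals all_analysis.
Import Order.TTheory GRing.Theory Num.Theory.
Import numFieldNormedType.Exports.

Set Implicit Arguments.
Unset Strict Implicit.
Unset Printing Implicit Defensive.

Local Open Scope classical_set_scope.
Local Open Scope ring_scope.

Definition is_code (n k : nat) (C : {vspace 'rV['F_2]_n}) : Prop := \dim C = k.

Definition dual_code (n : nat) (C : {vspace 'rV['F_2]_n}) : set 'rV['F_2]_n :=
  [set v | forall c, c \in C -> \sum_(i < n) c 0 i * v 0 i = 0].

Definition self_dual (n : nat) (C : {vspace 'rV['F_2]_n}) : Prop :=
  [set c | c \in C] = dual_code C.

Definition hamming_weight (n : nat) (c : 'rV['F_2]_n) : nat :=
  #|[set i : 'I_n | c 0 i != 0]%SET|.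

Definition weight_enum (R : realType) (n : nat) (C : {vspace 'rV['F_2]_n})
    (x y : R) : R :=
  \sum_(c : 'rV['F_2]_n | c \in C)
    x ^+ (n - hamming_weight c) * y ^+ hamming_weight c.

Definition f_code (R : realType) (n : nat) (C : {vspace 'rV['F_2]_n}) (t : R) : R :=
  weight_enum C (Num.sqrt (1 + t)) (Num.sqrt (1 - t)).
Arguments f_code R {n} C t.

Definition h_poly (R : realType) (t : R) : R := t ^+ 4 - t ^+ 2 + 1.

Definition int_lattice (R : realType) (n : nat) : set 'rV[R]_n :=
  [set map_mx intr z | z in [set: 'rV[int]_n]].
Arguments int_lattice : clear implicits.

Definition lift01 (R : realType) (n : nat) (c : 'rV['F_2]_n) : 'rV[R]_n :=
  map_mx (fun b : 'F_2 => (nat_of_ord b)%:R) c.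

Definition constructionA (R : realType) (n : nat) (C : {vspace 'rV['F_2]_n}) :
    set 'rV[R]_n :=
  [set (Num.sqrt 2)^-1 *: (lift01 R c + 2 *: z)
     | c in [set c | c \in C] & z in int_lattice R n].
Arguments constructionA R {n} C.

Definition sqnorm (R : realType) (n : nat) (v : 'rV[R]_n) : R :=
  \sum_(i < n) v 0 i ^+ 2.

(* The value of the theta series at the point i * tau of the imaginary axis,
   as a sum of nonnegative terms in [0, +oo]; for a lattice and tau > 0 it is
   finite. *)
Definition theta_series (R : realType) (n : nat) (L : set 'rV[R]_n) (tau : R) :
    \bar R :=
  (\esum_(v in L) (expR (- pi * tau * sqnorm v))%:E)%E.

Definition theta_ratio (R : realType) (n : nat) (L : set 'rV[R]_n) (tau : R) : R :=
  fine (theta_series L tau) / fine (theta_series (int_lattice R n) tau).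

Definition alpha_coef (l : nat) (a : nat -> rat) (j : nat) : rat :=
  \sum_(j <= r < l.+1) r`!%:R / (r - j)`!%:R * a r * (3 / 4) ^+ (r - j).

Definition beta_coef (l : nat) (a : nat -> rat) (j : nat) : rat :=
  \sum_(j <= r < l.+1) r`!%:R / (r - j)`!%:R * a r.

(* The derivative is relative to [a, b], hence one-sided at the end points:
   f_code is only meaningful on [0, 1], and since Num.sqrt is 0 on negative
   arguments its total extension may have a kink at 1. *)
Definition has_derivative_on (R : realType) (a b : R) (f : R -> R) (t d : R) : Prop :=
  (f s - f t) / (s - t) @[s --> within `[a, b] t^'] --> d.

(* The sign condition on the left is imposed on the open interval ]a, t0[: the
   functions of interest are polynomials in t ^+ 2, so that their derivative
   vanishes at the left end point 0. *)
Definition U_shaped (R : realType) (f : R -> R) (a b t0 : R) : Prop :=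
  t0 \in `[a, b] /\
  exists f' : R -> R,
    [/\ {in `[a, b], forall t, has_derivative_on a b f t (f' t)},
        (forall t, a < t < t0 -> f' t < 0),
        f' t0 = 0 &
        (forall t, t0 < t <= b -> 0 < f' t)].

(* The set of global minimizers of D over ]0, +oo[. *)
Definition argmin_pos (R : realType) (D : R -> R) : set R :=
  [set tau | 0 < tau /\ forall s, 0 < s -> D tau <= D s].

(* Main.v *)
Require Import Defs.
From mathcomp Require Import all_boot all_order all_algebra.
From mathcomp Require Import all_classical all_reals all_analysis.
From mathcomp Require Import polyrcf.
From mathcomp Require Import ring lra zify.
Import Order.TTheory GRing.Theory Num.Theory.
Import numFieldNormedType.Exports.

(** Why the theorem holds.

    Put P(u) = \sum_r a_r u^r, so that f(t) = 2^k P(h(t)) on [0, 1].  Since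
    h(t) = (t^2 - 1/2)^2 + 3/4, the map h sends [0, 1] into [3/4, 1], with
    value 1 at t = 1 and minimal value 3/4 exactly where t^2 = 1/2.  All the
    claims follow once P is known to increase on [3/4, 1] and the argument
    t(tau) at which f gives the theta series ratio is known to satisfy
    t(tau)^2 = 1/2 exactly for tau = 1.

    P increases ([derivn_gt0], [linear_coef_ge0]).  The numbers alpha_j and
    beta_j are the values of the j-th derivative of P at 3/4 and at 1.  The
    derivative of order l - 1 is affine and positive at both ends, hence
    positive in between; each derivative of lower order is then increasing
    and already positive at 3/4.  When l = 1 there is no condition on the
    coefficients, but the code itself forces a_1 >= 0: words of weight 2 in a
    self-dual code have disjoint supports, so there are at most n / 2 of them,
    and this makes f(1 - s) at most 2^k + O(s^2), while it equals
    2^k (1 - 2 a_1 s) + O(s^2).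

    The ratio is a value of f ([theta_ratio_constructionA]).  Write
    theta3(tau) and theta2(tau) for the sums of exp(-pi tau z^2) over the
    integers z and over the half-integers z.  Splitting the lattice into the
    classes of the code factors its theta series into
    W_C(theta3(2 tau), theta2(2 tau)), which is homogeneous in its arguments;
    the identity theta3(tau)^2 = theta3(2 tau)^2 + theta2(2 tau)^2 puts the
    pair of arguments in the form (sqrt(1 + t), sqrt(1 - t)) up to a factor.

    The value at tau = 1 ([theta_lemniscatic]).  The duplication formulas give
    t(tau)^2 = 1 - (theta2(tau) / theta3(tau))^4, so that
    theta3(1)^4 = 2 theta2(1)^4 is needed.  This follows from
    theta3(1/4) = 2 theta3(4), the inversion formula at a single point
    ([gauss_series_quarter]).  It is obtained as a limit of a finite identity
    ([discrete_poisson]): averaging the even power cos^(2m) over the multiples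
    of pi / 2K selects the binomial coefficients C(2m, m + d) with 2K | d.
    When K^2 / m tends to a positive limit both sides become Gaussian sums.
    The normalizing factor is eliminated by using the identity twice, for K
    and 2K with the same m.

    Uniqueness ([theta_ratio_neq]).  By the duplication formulas, equality of
    theta2 / theta3 at tau and sig propagates to 2^j tau and 2^j sig for
    all j.  There the quotient decays like exp(-pi 2^j tau / 4), which forces
    tau = sig. *)

Set Implicit Arguments.
Unset Strict Implicit.
Unset Printing Implicit Defensive.

Local Open Scope classical_set_scope.
Local Open Scope ring_scope.

(** * A discrete Poisson summation formula *)

Lemma sum_binS (V : zmodType) (n : nat) (F : nat -> V) :
  \sum_(0 <= r < n.+2) F r *+ 'C(n.+1, r) =
  \sum_(0 <= r < n.+1) (F r + F r.+1) *+ 'C(n, r).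
Proof.
rewrite big_nat_recl //= bin0.
under eq_bigr do rewrite binS mulrnDr.
rewrite big_split /= addrA.
under [RHS]eq_bigr do rewrite mulrnDl.
rewrite [RHS]big_split /=; congr (_ + _).
rewrite [in RHS]big_nat_recl //= bin0; congr (_ + _).
by rewrite big_nat_recr //= bin_small // mulr0n addr0.
Qed.

(** The phase [y] is what lets the induction close: multiplying by [2 * cos x]
    turns [cos y] into [cos (y + x) + cos (y - x)]. *)
Lemma cos_pow_expand (R : realType) (x : R) (n : nat) (y : R) :
  (2 * cos x) ^+ n * cos y =
  \sum_(0 <= r < n.+1) cos ((n%:R - 2 * r%:R) * x + y) *+ 'C(n, r).
Proof.
elim: n y => [|n IH] y.
  by rewrite big_nat1 expr0 bin0 mul1r mulr0 subrr mul0r add0r.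
rewrite sum_binS.
rewrite exprSr -mulrA.
have -> : 2 * cos x * cos y = cos (y + x) + cos (y - x).
  by rewrite cosD cosB; ring.
rewrite mulrDr !IH -big_split /=; apply: eq_bigr => r _.
by rewrite -mulrnDl; congr (_ *+ _); congr (cos _ + cos _); rewrite -!natr1; ring.
Qed.

Lemma fold_binomial_sum (V : zmodType) (m : nat) (g h : nat -> V) :
  (forall d, (d <= m)%N -> g (m + d)%N = h d /\ g (m - d)%N = h d) ->
  \sum_(0 <= r < (2 * m).+1) g r *+ 'C(2 * m, r) =
  h 0%N *+ 'C(2 * m, m) +
    (\sum_(0 <= d < m) h d.+1 *+ 'C(2 * m, m + d.+1)) *+ 2.
Proof.
move=> gh.
rewrite (big_cat_nat (n := m)) //=; last by lia.
rewrite (big_cat_nat (m := m) (n := m.+1)) //=; last by lia.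
rewrite big_nat1.
have -> : g m = h 0%N by have [+ _] := gh 0%N isT; rewrite addn0.
rewrite addrCA; congr (_ + _); rewrite mulr2n; congr (_ + _).
  rewrite big_nat_rev /= add0n.
  apply: eq_big_nat => d /andP[_ dm].
  have [_ <-] := gh d.+1 dm.
  congr (_ *+ _); rewrite -[in RHS]bin_sub; last by lia.
  by congr 'C(_, _); lia.
rewrite -[X in \sum_(X <= _ < _) _]add0n big_addn.
have -> : ((2 * m).+1 - m.+1 = m)%N by lia.
apply: eq_big_nat => d /andP[_ dm].
have [<- _] := gh d.+1 dm.
have -> : (d + m.+1 = m + d.+1)%N by lia.
by [].
Qed.

Lemma cos_pow_even (R : realType) (x : R) (m : nat) :
  (2 * cos x) ^+ (2 * m) =
  'C(2 * m, m)%:R +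
   2 * \sum_(0 <= d < m) 'C(2 * m, m + d.+1)%:R * cos (2 * d.+1%:R * x).
Proof.
have := cos_pow_expand x (2 * m) 0; rewrite cos0 mulr1 => ->.
rewrite (@fold_binomial_sum _ m _ (fun d => cos (2 * d%:R * x))); last first.
  move=> d dm; rewrite addr0; split.
    rewrite -cosN; congr cos; rewrite natrM natrD; ring.
  congr cos; rewrite natrB // natrM; ring.
rewrite mulr0 mul0r cos0; congr (_ + _).
rewrite mulr_natl; congr (_ *+ _); apply: eq_bigr => d _.
by rewrite [RHS]mulr_natl.
Qed.

Lemma cos_natpi (R : realType) (d : nat) : cos (d%:R * pi : R) = (-1) ^+ d.
Proof.
have := @alternatingn _ _ _ _ (@cosDpi R) d 0.
by rewrite add0r cos0 mulr1 mulr_natl.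
Qed.

Lemma sin_natpi (R : realType) (d : nat) : sin (d%:R * pi : R) = 0.
Proof.
have := @alternatingn _ _ _ _ (@sinDpi R) d 0.
by rewrite add0r sin0 mulr0 mulr_natl.
Qed.

Lemma cos_nat2pi (R : realType) (d : nat) (x : R) :
  cos (x + (2 * d)%:R * pi) = cos x.
Proof.
by rewrite cosD cos_natpi sin_natpi mulr0 subr0 exprM sqrrN expr1n expr1n mulr1.
Qed.

(** Telescoping sum: [2 * sin (x / 2) * cos (j * x)] is the difference of two
    consecutive values of [sin (j * x + x / 2)]. *)
Lemma dirichlet_kernel (R : realType) (K : nat) (x : R) :
  sin (x / 2) * (1 + 2 * \sum_(0 <= j < K) cos (j.+1%:R * x)) =
  sin (K%:R * x + x / 2).
Proof.
elim: K => [|K IH].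
  by rewrite big_nil mulr0 addr0 mulr1 mul0r add0r.
rewrite big_nat_recr //= (mulrDr 2) addrA mulrDr IH.
have -> : K%:R * x + x / 2 = K.+1%:R * x - x / 2.
  by rewrite -natr1; field.
rewrite sinB sinD; ring.
Qed.

(** Orthogonality of the real characters of Z/2K: the sum runs over a full
    period of [2 * K] points, folded by parity into the terms 0, K and twice
    the terms in between. *)
Lemma cos_roots_sum (R : realType) (K d : nat) : (0 < K)%N ->
  1 + 2 * (\sum_(0 <= j < K) cos (j.+1%:R * (d%:R * pi / K%:R)))
    - cos (d%:R * pi) = (2 * K)%:R * (2 * K %| d)%:R :> R.
Proof.
move=> K0; have K0R : K%:R != 0 :> R by rewrite pnatr_eq0 -lt0n.
case: (boolP (2 * K %| d)%N) => [/dvdnP[q ->]|ndvd].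
  have -> : \sum_(0 <= j < K) cos (j.+1%:R * ((q * (2 * K))%:R * pi / K%:R)) =
            K%:R :> R.
    under eq_bigr => j _.
      have -> : j.+1%:R * ((q * (2 * K))%:R * pi / K%:R) =
                0 + (2 * (j.+1 * q))%:R * pi :> R.
        by rewrite !natrM; field.
      rewrite cos_nat2pi cos0; over.
    by rewrite big_const_nat subn0 iter_addr_0.
  have -> : (q * (2 * K))%:R * pi = 0 + (2 * (q * K))%:R * pi :> R.
    by rewrite !natrM; ring.
  by rewrite cos_nat2pi cos0 natrM mulr1; ring.
rewrite mulr0; apply/eqP; rewrite subr_eq0; apply/eqP.
set x := d%:R * pi / K%:R.
have sx : sin (x / 2) != 0.
  have -> : x / 2 = (d %% (2 * K))%:R * pi / (2 * K)%:R + (d %/ (2 * K))%:R * pi.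
    rewrite /x {1}(divn_eq d (2 * K)) natrD !natrM; field.
    by rewrite K0R.
  rewrite sinD sin_natpi mulr0 addr0 cos_natpi mulf_neq0 ?signr_eq0 //.
  rewrite gt_eqF // sin_gt0_pi //.
  have p0 := @pi_gt0 R.
  have K2 : 0 < (2 * K)%:R :> R by rewrite ltr0n; lia.
  rewrite divr_gt0 ?mulr_gt0 //=; last first.
    by rewrite ltr0n lt0n -/(dvdn _ _) ndvd.
  rewrite ltr_pdivrMr // mulrC ltr_pM2l // ltr_nat ltn_mod; lia.
apply: (mulfI sx); rewrite dirichlet_kernel sinD.
have -> : K%:R * x = d%:R * pi by rewrite /x; field.
by rewrite sin_natpi mul0r add0r mulrC.
Qed.

Lemma sum_multiples (V : zmodType) (m L : nat) (c : nat -> V) :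
  (0 < L)%N -> (forall d, (m < d)%N -> c d = 0) ->
  \sum_(0 <= d < m) c d.+1 *+ (L %| d.+1)%N =
  \sum_(0 <= v < m) c (L * v.+1)%N.
Proof.
move=> L0 c0.
transitivity (\sum_(0 <= d < m) \sum_(0 <= v < m)
    (c d.+1 *+ (d.+1 == L * v.+1)%N)).
  apply: eq_big_nat => d /andP[_ dm].
  case: (boolP (L %| d.+1)%N) => [/dvdnP[q e]|nd]; last first.
    rewrite big1 // => v _; case: eqP => // e; case/negP: nd.
    by rewrite e dvdn_mulr.
  case: q e => [|q] e; first by rewrite mul0n in e.
  have qm : (q < m)%N by nia.
  rewrite (bigD1_seq q) ?mem_index_iota ?iota_uniq //=.
  rewrite e mulnC eqxx big1 ?addr0 // => v vq; case: eqP => // e'.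
  by case/negP: vq; apply/eqP; nia.
rewrite exchange_big /=; apply: eq_big_nat => v /andP[_ vm].
case: (leqP (L * v.+1) m) => h.
  have e : ((L * v.+1).-1.+1 = L * v.+1)%N by rewrite prednK //; nia.
  rewrite (bigD1_seq (L * v.+1).-1) ?mem_index_iota ?iota_uniq //=; last by lia.
  rewrite e eqxx big1 ?addr0 // => d dq; case: eqP => // e'.
  by case/negP: dq; rewrite -e'.
rewrite c0 // big_nat_cond big1 // => d /andP[dm _].
by case: eqP => // e'; lia.
Qed.

(** The sum of [cos (pi * j / (2 * K)) ^+ (2 * m)] over a full period, folded
    by parity; the term [j = K] vanishes for positive [m], so that counting it
    twice is harmless. *)
Definition cosine_sum (R : realType) (K m : nat) : R :=
  1 + 2 * \sum_(0 <= j < K) cos (j.+1%:R * pi / (2 * K)%:R) ^+ (2 * m).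

(** The binomial coefficients at distance a multiple of [2 * K] from the
    centre, relative to the central one.  Terms with [2 * K * v.+1 > m] vanish,
    which makes [m] a sufficient number of terms. *)
Definition binomial_sum (R : realType) (K m : nat) : R :=
  1 + 2 * \sum_(0 <= v < m) ('C(2 * m, m + 2 * K * v.+1)%:R / 'C(2 * m, m)%:R).

(** Expand each even power of a cosine in cosines of multiple angles and sum
    over [j] first: orthogonality keeps the frequencies divisible by [2 * K]. *)
Lemma discrete_poisson (R : realType) (K m : nat) : (0 < K)%N -> (0 < m)%N ->
  cosine_sum R K m =
  K%:R * (2 * 'C(2 * m, m)%:R / 2 ^+ (2 * m)) * binomial_sum R K m.
Proof.
move=> K0 m0.
have K0R : K%:R != 0 :> R by rewrite pnatr_eq0 -lt0n.
have C0 : 'C(2 * m, m)%:R != 0 :> R.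
  by rewrite pnatr_eq0 -lt0n bin_gt0; lia.
have p2 : 2 ^+ (2 * m) != 0 :> R by rewrite expf_neq0.
apply: (mulfI p2); rewrite /cosine_sum.
set S := \sum_(0 <= j < K) _.
have cK : cos (K%:R * pi / (2 * K)%:R) ^+ (2 * m) = 0 :> R.
  have -> : K%:R * pi / (2 * K)%:R = pi / 2 :> R by rewrite natrM; field.
  by rewrite cos_pihalf expr0n (_ : (2 * m == 0)%N = false) //; lia.
have e1 : 2 ^+ (2 * m) * S = K%:R * 'C(2 * m, m)%:R +
    2 * \sum_(0 <= d < m) 'C(2 * m, m + d.+1)%:R *
        \sum_(0 <= j < K) cos (j.+1%:R * (d.+1%:R * pi / K%:R)).
  rewrite /S [LHS]mulr_sumr.
  under eq_bigr do rewrite -exprMn cos_pow_even.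
  rewrite big_split /= big_const_nat subn0 iter_addr_0 mulr_natl; congr (_ + _).
  rewrite -mulr_sumr exchange_big /=; congr (_ * _); apply: eq_bigr => d _.
  rewrite mulr_sumr; apply: eq_bigr => j _; congr (_ * cos _).
  by rewrite natrM; field.
have e2 : 2 ^+ (2 * m) * 1 = 'C(2 * m, m)%:R +
    2 * \sum_(0 <= d < m) 'C(2 * m, m + d.+1)%:R :> R.
  have := cos_pow_even (0 : R) m; rewrite cos0 !mulr1 => ->.
  by congr (_ + 2 * _); apply: eq_bigr => d _; rewrite mulr0 cos0 mulr1.
have e3 : 2 ^+ (2 * m) * cos (K%:R * pi / (2 * K)%:R) ^+ (2 * m) =
   'C(2 * m, m)%:R +
    2 * \sum_(0 <= d < m) 'C(2 * m, m + d.+1)%:R * cos (d.+1%:R * pi) :> R.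
  rewrite -exprMn cos_pow_even; congr (_ + 2 * _); apply: eq_bigr => d _.
  by congr (_ * cos _); rewrite natrM; field.
rewrite cK mulr0 in e3.
rewrite mulrDr e2 mulrCA e1.
rewrite -[LHS]subr0 [in X in _ - X = _]e3.
transitivity ((2 * K)%:R * 'C(2 * m, m)%:R + 2 * \sum_(0 <= d < m)
   'C(2 * m, m + d.+1)%:R * (1 + 2 * (\sum_(0 <= j < K)
      cos (j.+1%:R * (d.+1%:R * pi / K%:R))) - cos (d.+1%:R * pi)) :> R).
  under [X in _ = _ + 2 * X]eq_bigr do rewrite mulrBr mulrDr mulr1 mulrCA.
  rewrite sumrB big_split /= -mulr_sumr natrM; ring.
under eq_bigr => d _.
  rewrite cos_roots_sum // mulrCA mulr_natr; over.
rewrite -mulr_sumr.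
rewrite (@sum_multiples _ m (2 * K) (fun d => 'C(2 * m, m + d)%:R)) //; last 2 first.
- by lia.
- by move=> d md; rewrite bin_small //; lia.
rewrite /binomial_sum -mulr_suml natrM; field.
by rewrite C0 p2.
Qed.

(** * Scaling limits: Tannery's theorem and the Gaussian regime *)

Lemma cvgn_sum (R : realType) (F : nat -> nat -> R) (f : nat -> R) (M : nat) :
  (forall j, (fun N => F N j) @ \oo --> f j) ->
  (fun N => series (F N) M) @ \oo --> series f M.
Proof.
move=> Ff; elim: M => [|M IH].
  have -> : (fun N => series (F N) 0%N) = cst 0.
    by apply/funext => N; rewrite seriesEnat /= big_nil.
  by rewrite seriesEnat /= big_nil; exact: cvg_cst.
have -> : (fun N => series (F N) M.+1) = (fun N => series (F N) M + F N M).
  by apply/funext => N; rewrite !seriesEnat /= big_nat_recr.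
have -> : series f M.+1 = series f M + f M.
  by rewrite !seriesEnat /= big_nat_recr.
exact: cvgD.
Qed.

(** Dominated convergence for sums whose number of terms grows with [N]. *)
Lemma tannery (R : realType) (F : nat -> nat -> R) (G f : nat -> R)
    (B : nat -> nat) :
  cvgn (series G) ->
  (\forall N \near \oo, forall j, 0 <= F N j <= G j) ->
  (forall j, (fun N => F N j) @ \oo --> f j) ->
  (forall k, \forall N \near \oo, (k <= B N)%N) ->
  cvgn (series f) /\ (fun N => series (F N) (B N)) @ \oo --> limn (series f).
Proof.
move=> cG FG Ff Boo.
have f_bound j : 0 <= f j <= G j.
  apply/andP; split.
    by apply: (cvgr_to_ge (Ff j)); apply: filterS FG => N /(_ j) /andP[].
  by apply: (cvgr_to_le (Ff j)); apply: filterS FG => N /(_ j) /andP[].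
have cf : cvgn (series f).
  apply: series_le_cvg cG => n; have /andP[f0 fG] := f_bound n => //.
  exact: le_trans fG.
split => //.
have G0 j : 0 <= G j by have /andP[f0 fG] := f_bound j; exact: le_trans fG.
have tail (u : nat -> R) (uG : forall j, 0 <= u j <= G j) (m n : nat) :
    (m <= n)%N -> `|series u n - series u m| <= limn (series G) - series G m.
  move=> mn; rewrite sub_series_geq // ger0_norm; last first.
    by apply: sumr_ge0 => j _; have /andP[] := uG j.
  have le1 : \sum_(m <= k < n) u k <= \sum_(m <= k < n) G k.
    by apply: ler_sum => j _; have /andP[] := uG j.
  apply: (le_trans le1); rewrite -sub_series_geq // lerD2r.
  apply: nondecreasing_cvgn_le => //; exact/nondecreasing_series.
(* Cut at M, where the tail of the majorant is below e / 3: the sum up to M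
   converges term by term, and both remainders are controlled by that tail. *)
apply/cvgrPdist_le => e e0.
have e3 : 0 < e / 3 by rewrite divr_gt0.
have /cvgrPdist_le /(_ _ e3) [M _ HM] := cG.
have {HM} := HM M (leqnn M) => HM.
have /cvgrPdist_le /(_ _ e3) HF := @cvgn_sum R F f M Ff.
have flim : `|limn (series f) - series f M| <= e / 3.
  apply: (le_trans _ (le_trans (ler_norm _) HM)).
  have cfM : (fun n => `|series f n - series f M|) @ \oo -->
      `|limn (series f) - series f M|.
    by apply: cvg_norm; apply: cvgB => //; exact: cvg_cst.
  by apply: (cvgr_to_le cfM); exists M => // n; exact: tail.
near=> N.
have FN : forall j, 0 <= F N j <= G j by near: N.
have BN : (M <= B N)%N by near: N; exact: Boo.
have h1 : `|series f M - series (F N) M| <= e / 3 by near: N.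
have h2 := le_trans (tail _ FN _ _ BN) (le_trans (ler_norm _) HM).
rewrite (_ : _ - _ = (limn (series f) - series f M) +
   (series f M - series (F N) M) - (series (F N) (B N) - series (F N) M)); last by ring.
apply: (le_trans (ler_normB _ _)).
apply: (@le_trans _ _ (e / 3 + e / 3 + e / 3)); last by lra.
rewrite lerD //; apply: (le_trans (ler_normD _ _)); exact: lerD.
Unshelve. all: by end_near. Qed.

Lemma onem_expR_bounds (R : realType) (m : nat) (y : R) : 0 <= y < 1 ->
  expR (- (m%:R * y / (1 - y))) <= (1 - y) ^+ m <= expR (- (m%:R * y)).
Proof.
move=> /andP[y0 y1]; have y1' : 0 < 1 - y by rewrite subr_gt0.
apply/andP; split; last first.
  rewrite -mulrN expRM_natl lerXn2r ?nnegrE ?expR_ge0 ?(ltW y1') //.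
  exact: expR_ge1Dx.
rewrite -mulrA -mulrN expRM_natl lerXn2r ?nnegrE ?expR_ge0 ?(ltW y1') //.
rewrite expRN -[leRHS]invrK lef_pV2 ?posrE ?expR_gt0 ?invr_gt0 //.
apply: le_trans (expR_ge1Dx _).
by rewrite le_eqVlt; apply/orP; left; apply/eqP; field; rewrite gt_eqF.
Qed.

Lemma cvg_onem_pow (R : realType) (m : nat -> nat) (y : nat -> R) (l : R) :
  (\forall N \near \oo, 0 <= y N < 1) -> y @ \oo --> (0 : R) ->
  (fun N => (m N)%:R * y N) @ \oo --> l ->
  (fun N => (1 - y N) ^+ m N) @ \oo --> expR (- l).
Proof.
move=> y01 y0 myl.
apply: (@squeeze_cvgr _ _ _ _ (fun N => expR (- ((m N)%:R * y N / (1 - y N))))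
    (fun N => expR (- ((m N)%:R * y N)))).
- by near=> N; apply: onem_expR_bounds; near: N.
- apply: continuous_cvg; first exact: continuous_expR.
  apply: cvgN; rewrite -[X in _ --> X]mulr1; apply: cvgM => //.
  rewrite -[X in _ --> X]invr1; apply: cvgV; first exact: oner_neq0.
  rewrite -[X in _ --> X]subr0; apply: cvgB => //; exact: cvg_cst.
- apply: continuous_cvg; first exact: continuous_expR.
  exact: cvgN.
Unshelve. all: by end_near. Qed.

(** By the mean value theorem [sin x = x * cos c] for some [c] in ]0, x[. *)
Lemma sin_bounds (R : realType) (x : R) : 0 <= x <= pi ->
  x * cos x <= sin x <= x.
Proof.
rewrite le_eqVlt => /andP[/predU1P[<- _|x0 xpi]].
  by rewrite mul0r sin0 lexx.
have [c] := @MVT R sin cos 0 x x0 (fun y _ => @is_derive_sin R y)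
   (continuous_subspaceT (@continuous_sin R)).
rewrite in_itv /= => /andP[c0 cx]; rewrite sin0 !subr0 => ->.
apply/andP; split; last first.
  by rewrite -[leRHS]mul1r ler_pM2r ?cos_le1.
rewrite mulrC ler_pM2r //; apply/ltW.
by rewrite ltr_cos // in_itv /=; apply/andP; split; lra.
Qed.

(** The sum of [expR (- (lam * z ^+ 2))] over all integers [z]. *)
Definition gauss_series (R : realType) (lam : R) : R :=
  1 + 2 * limn (series (fun j : nat => expR (- (lam * j.+1%:R ^+ 2)))).

Lemma cvg_series_exp_neg (R : realType) (c : R) : 0 < c ->
  cvgn (series (fun j : nat => expR (- (c * j.+1%:R)))).
Proof.
move=> c0.
have -> : (fun j : nat => expR (- (c * j.+1%:R))) =
          geometric (expR (- c)) (expR (- c)).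
  by apply/funext => j /=; rewrite -exprS -expRM_natl mulrN mulrC.
by apply: is_cvg_geometric_series; rewrite ger0_norm ?expR_ge0 // expR_lt1 oppr_lt0.
Qed.

(** A crude form of Jordan's inequality; any positive constant gives the
    domination needed below. *)
Lemma sin_linear_bound (R : realType) :
  exists2 c : R, 0 < c & forall x, 0 <= x <= pi / 2 -> c * x <= sin x.
Proof.
have pi2 := @pi_ge2 R; have pih := @pihalf_lt2 R.
have s1 : 0 < sin 1 :> R by rewrite sin2_gt0 // ltr01 ltr1n.
have c1 := @cos1_gt0 R.
exists (Num.min (cos 1) (sin 1 / 2)) => [|x /andP[x0 xpi]].
  by rewrite lt_min c1 divr_gt0.
case: (leP x 1) => x1.
  have /andP[h _] : x * cos x <= sin x <= x by apply: sin_bounds; lra.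
  apply: le_trans h; rewrite mulrC ler_wpM2l // ge_min; apply/orP; left.
  by rewrite leNgt ltr_cos ?in_itv /= -?leNgt //; apply/andP; split; lra.
have h : sin 1 <= sin x.
  by rewrite leNgt ltr_sin ?in_itv /= -?leNgt ?(ltW x1) //; apply/andP; split; lra.
apply: le_trans h; apply: (@le_trans _ _ (sin 1 / 2 * x)).
  by rewrite ler_wpM2r ?ge_min ?lexx ?orbT.
by rewrite -mulrA ger_pMr //; lra.
Qed.

Lemma cvg_sqr (R : realType) (u : nat -> R) (a : R) :
  u @ \oo --> a -> (fun N => u N ^+ 2) @ \oo --> a ^+ 2.
Proof. by move=> ua; rewrite expr2; exact: cvgM. Qed.

Lemma cvg_inv_2nat (R : realType) (K : nat -> nat) :
  (forall k, \forall N \near \oo, (k <= K N)%N) ->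
  (fun N => (2 * K N)%:R^-1) @ \oo --> (0 : R).
Proof.
move=> Koo.
apply/cvgrPdist_le => e e0.
have [k ke] : exists k : nat, e^-1 <= k%:R.
  have /archi_boundP h : 0 <= e^-1 by rewrite invr_ge0 ltW.
  by exists (Num.bound e^-1); exact: ltW.
apply: filterS (Koo k.+1) => N kN.
have kN' : e^-1 <= (2 * K N)%:R by apply: (le_trans ke); rewrite ler_nat; lia.
rewrite sub0r normrN ger0_norm ?invr_ge0 // invf_ple ?posrE //.
by rewrite ltr0n; lia.
Qed.

Lemma central_binS (R : realType) (m d : nat) : (d <= m)%N ->
  'C(2 * m, m + d.+1)%:R =
  'C(2 * m, m + d)%:R * (1 - (2 * d + 1)%:R / (m + d.+1)%:R) :> R.
Proof.
move=> dm; have md : (m + d.+1)%:R != 0 :> R by rewrite pnatr_eq0; lia.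
have := mul_bin_left (2 * m) (m + d).
have -> : ((m + d).+1 = m + d.+1)%N by lia.
have -> : (2 * m - (m + d) = m - d)%N by lia.
move/(congr1 (fun n : nat => n%:R : R)); rewrite !natrM => h.
apply: (mulfI md); rewrite h mulrCA mulrC; congr (_ * _).
rewrite natrB // mulrBr mulr1 mulrCA divff // mulr1.
by rewrite (natrD _ m) (natrD _ (2 * d)) natrM -natr1; ring.
Qed.

(** The ratio of consecutive coefficients is [1 - (2 * d + 1) / (m + d + 1)],
    and the numerators [2 * d + 1] add up to a square.  Leaving [E] free allows
    both the sharp choice [m + d] for the limit and the uniform choice [2 * m]
    for the domination. *)
Lemma central_bin_upper (R : realType) (m d E : nat) : (m + d <= E)%N ->
  'C(2 * m, m + d)%:R <= 'C(2 * m, m)%:R * expR (- (d%:R ^+ 2 / E%:R)) :> R.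
Proof.
elim: d => [|d IH] mdE.
  by rewrite addn0 expr0n mul0r oppr0 expR0 mulr1.
case: (leqP m d) => dm.
  by rewrite bin_small ?mulr_ge0 ?ler0n ?expR_ge0 //; lia.
rewrite central_binS; last by lia.
have md0 : 0 < (m + d.+1)%:R :> R by rewrite ltr0n; lia.
have E0 : 0 < E%:R :> R by rewrite ltr0n; lia.
have f0 : 0 <= 1 - (2 * d + 1)%:R / (m + d.+1)%:R :> R.
  by rewrite subr_ge0 ler_pdivrMr // mul1r ler_nat; lia.
apply: (@le_trans _ _ ('C(2 * m, m)%:R * expR (- (d%:R ^+ 2 / E%:R)) *
    (1 - (2 * d + 1)%:R / (m + d.+1)%:R))).
  by rewrite ler_wpM2r // IH //; lia.
rewrite -mulrA ler_wpM2l ?ler0n //.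
have -> : - (d.+1%:R ^+ 2 / E%:R) =
   - (d%:R ^+ 2 / E%:R) + - ((2 * d + 1)%:R / E%:R) :> R.
  by rewrite (natrD _ (2 * d)) natrM -natr1; field; rewrite gt_eqF.
rewrite expRD ler_wpM2l ?expR_ge0 //; apply: le_trans (expR_ge1Dx _).
by rewrite lerD2l lerN2 ler_wpM2l ?ler0n // lef_pV2 ?posrE // ler_nat.
Qed.

(** Same telescoping as for the upper bound, with [1 - y >= expR (- y / (1 - y))]. *)
Lemma central_bin_lower (R : realType) (m d E : nat) :
  (0 < E)%N -> (d + E <= m)%N ->
  'C(2 * m, m)%:R * expR (- (d%:R ^+ 2 / E%:R)) <= 'C(2 * m, m + d)%:R :> R.
Proof.
move=> Epos; elim: d => [|d IH] dE.
  by rewrite addn0 expr0n mul0r oppr0 expR0 mulr1.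
rewrite central_binS; last by lia.
have md0 : 0 < (m + d.+1)%:R :> R by rewrite ltr0n; lia.
have E0 : 0 < E%:R :> R by rewrite ltr0n; lia.
apply: (@le_trans _ _ ('C(2 * m, m)%:R * expR (- (d%:R ^+ 2 / E%:R)) *
    (1 - (2 * d + 1)%:R / (m + d.+1)%:R))); last first.
  rewrite ler_wpM2r ?IH //; last by lia.
  by rewrite subr_ge0 ler_pdivrMr // mul1r ler_nat; lia.
rewrite -mulrA ler_wpM2l ?ler0n //.
have -> : - (d.+1%:R ^+ 2 / E%:R) =
   - (d%:R ^+ 2 / E%:R) + - ((2 * d + 1)%:R / E%:R) :> R.
  by rewrite (natrD _ (2 * d)) natrM -natr1; field; rewrite gt_eqF.
rewrite expRD ler_wpM2l ?expR_ge0 // expRN.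
have -> : 1 - (2 * d + 1)%:R / (m + d.+1)%:R = (1 + (2 * d + 1)%:R / (m - d)%:R)^-1 :> R.
  have mdE : (m + d.+1)%:R = (m - d)%:R + (2 * d + 1)%:R :> R.
    by rewrite -natrD; congr _%:R; lia.
  have m0 : 0 < (m - d)%:R :> R by rewrite ltr0n; lia.
  rewrite mdE in md0 *; field.
  by rewrite !gt_eqF //.
have m0 : 0 < (m - d)%:R :> R by rewrite ltr0n; lia.
have q0 : 0 < 1 + (2 * d + 1)%:R / (m - d)%:R :> R by rewrite ltr_wpDr // divr_ge0.
rewrite lef_pV2 ?posrE ?expR_gt0 //.
apply: le_trans (expR_ge1Dx _); rewrite lerD2l.
by rewrite ler_wpM2l ?ler0n // lef_pV2 ?posrE // ler_nat; lia.
Qed.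

Section scaling_limit.
Variables (R : realType) (K m : nat -> nat) (lam : R).
Hypothesis lam0 : 0 < lam.
Hypothesis Koo : forall k, \forall N \near \oo, (k <= K N)%N.
Hypothesis Km : (fun N => (2 * K N)%:R ^+ 2 / (m N)%:R) @ \oo --> lam.

Lemma scaling_m_gt0 : \forall N \near \oo, (0 < m N)%N.
Proof.
apply: filterS (cvgr_gt _ Km _ lam0) => N; case: (m N) => // .
by rewrite invr0 mulr0 ltxx.
Qed.

Let mK : (fun N => (m N)%:R / (2 * K N)%:R ^+ 2) @ \oo --> lam^-1.
Proof.
have -> : (fun N => (m N)%:R / (2 * K N)%:R ^+ 2) =
          (fun N => ((2 * K N)%:R ^+ 2 / (m N)%:R)^-1 : R).
  by apply/funext => N; rewrite invf_div.
by apply: cvgV => //; rewrite gt_eqF.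
Qed.

(** With [x = pi * j / (2 * K)] small, [cos x ^+ (2 * m)] is
    [(1 - sin x ^+ 2) ^+ m], whose limit is governed by that of [m * x ^+ 2];
    the bound [c * x <= sin x] provides a summable majorant. *)
Lemma cvg_cosine_sum :
  (fun N => cosine_sum R (K N) (m N)) @ \oo --> gauss_series (pi ^+ 2 / lam).
Proof.
have [c c0 Hc] := sin_linear_bound R.
have p0 := @pi_gt0 R.
pose x j N : R := j.+1%:R * pi / (2 * K N)%:R.
pose F N j := if (j < K N)%N then (1 - sin (x j N) ^+ 2) ^+ m N else 0.
pose d := c ^+ 2 * pi ^+ 2 / (2 * lam).
have d0 : 0 < d by rewrite divr_gt0 ?mulr_gt0 ?exprn_gt0.
have xE j N : (m N)%:R * x j N ^+ 2 =
    pi ^+ 2 * j.+1%:R ^+ 2 * ((m N)%:R / (2 * K N)%:R ^+ 2).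
  by rewrite /x expr_div_n exprMn; ring.
have x_bound j N : (j < K N)%N -> 0 <= x j N <= pi / 2.
  move=> jK; rewrite /x; have K0 : 0 < (K N)%:R :> R by rewrite ltr0n; lia.
  have -> : j.+1%:R * pi / (2 * K N)%:R = pi / 2 * (j.+1%:R / (K N)%:R) :> R.
    by rewrite natrM; field; rewrite gt_eqF.
  rewrite mulr_ge0 ?divr_ge0 ?(ltW p0) //= ger_pMr ?divr_gt0 //.
  by rewrite ler_pdivrMr // mul1r ler_nat.
have x0 j : (fun N => x j N) @ \oo --> (0 : R).
  by rewrite -[X in _ --> X](mulr0 (j.+1%:R * pi)); apply: cvgMl_tmp; exact: cvg_inv_2nat.
have dom : \forall N \near \oo, forall j, 0 <= F N j <= expR (- (d * j.+1%:R)).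
  have lam2 : (2 * lam)^-1 < lam^-1.
    by rewrite ltf_pV2 ?posrE ?mulr_gt0 // ltr_pMl // ltr1n.
  apply: filterS (cvgr_ge _ mK _ lam2) => N mN j.
  rewrite /F; case: ifP => jK; last by rewrite lexx expR_ge0.
  have /andP[xx0 xx1] := x_bound j N jK.
  have s2 : 0 <= 1 - sin (x j N) ^+ 2 by rewrite -cos2sin2 sqr_ge0.
  rewrite exprn_ge0 //=.
  apply: (@le_trans _ _ (expR (- sin (x j N) ^+ 2) ^+ m N)).
    by rewrite lerXn2r ?nnegrE ?expR_ge0 // expR_ge1Dx.
  rewrite -expRM_natl ler_expR mulrN lerN2.
  apply: (@le_trans _ _ ((m N)%:R * (c * x j N) ^+ 2)); last first.
    have cx0 : 0 <= c * x j N by rewrite mulr_ge0 ?(ltW c0).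
    have cxs : c * x j N <= sin (x j N) by rewrite Hc ?xx0.
    by rewrite ler_wpM2l // lerXn2r ?nnegrE // (le_trans cx0).
  rewrite exprMn mulrCA xE /d.
  apply: (@le_trans _ _ (c ^+ 2 * (pi ^+ 2 * j.+1%:R ^+ 2 * (2 * lam)^-1))).
    have -> : c ^+ 2 * (pi ^+ 2 * j.+1%:R ^+ 2 / (2 * lam)) = d * j.+1%:R ^+ 2.
      by rewrite /d; ring.
    rewrite ler_wpM2l ?(ltW d0) // expr2 ler_peMr ?ler0n //.
    by rewrite ler1n.
  by rewrite !ler_wpM2l ?mulr_ge0 ?exprn_ge0 ?(ltW c0) ?(ltW p0).
have pt j : (fun N => F N j) @ \oo --> expR (- (pi ^+ 2 / lam * j.+1%:R ^+ 2)).
  have xl : (fun N => (m N)%:R * x j N ^+ 2) @ \oo -->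
            pi ^+ 2 / lam * j.+1%:R ^+ 2.
    have -> : (fun N => (m N)%:R * x j N ^+ 2) = (fun N =>
       pi ^+ 2 * j.+1%:R ^+ 2 * ((m N)%:R / (2 * K N)%:R ^+ 2)).
      by apply/funext => N; exact: xE.
    rewrite [X in _ --> X]mulrAC; exact: cvgMl_tmp.
  have s0 : (fun N => sin (x j N) ^+ 2) @ \oo --> (0 : R).
    have -> : 0 = sin 0 ^+ 2 :> R by rewrite sin0 expr0n.
    apply: cvg_sqr; apply: continuous_cvg (x0 j); exact: continuous_sin.
  have H : (fun N => (1 - sin (x j N) ^+ 2) ^+ m N) @ \oo -->
      expR (- (pi ^+ 2 / lam * j.+1%:R ^+ 2)).
    apply: cvg_onem_pow => //.
      apply: filterS (cvgr_lt _ s0 _ ltr01) => N ->.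
      by rewrite sqr_ge0.
    apply: (@squeeze_cvgr _ _ _ _
       (fun N => (m N)%:R * x j N ^+ 2 * cos (x j N) ^+ 2)
       (fun N => (m N)%:R * x j N ^+ 2)) => //.
      apply: filterS (Koo j.+1) => N jK.
      have /andP[xx0 xx1] := x_bound j N jK.
      have /andP[sl su] : x j N * cos (x j N) <= sin (x j N) <= x j N.
        by apply: sin_bounds; rewrite xx0 /=; lra.
      have cx : 0 <= cos (x j N) by apply: cos_ge0_pihalf; apply/andP; split; lra.
      have xc0 := mulr_ge0 xx0 cx.
      have ss : 0 <= sin (x j N) by apply: le_trans sl.
      rewrite -[X in X <= _]mulrA -exprMn; apply/andP; split; apply: ler_wpM2l => //.
        by rewrite lerXn2r ?nnegrE ?xc0.
      by rewrite lerXn2r ?nnegrE.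
    rewrite -[X in _ --> X]mulr1; apply: cvgM => //.
    have -> : 1 = cos 0 ^+ 2 :> R by rewrite cos0 expr1n.
    apply: cvg_sqr; apply: continuous_cvg (x0 j); exact: continuous_cos.
  apply: cvg_trans H; apply: near_eq_cvg.
  by apply: filterS (Koo j.+1) => N jK; rewrite /F jK.
have [_ lim] := tannery (cvg_series_exp_neg d0) dom pt Koo.
rewrite /gauss_series; apply: cvgD; first exact: cvg_cst.
apply: cvgMl_tmp; apply: cvg_trans lim; apply: near_eq_cvg; apply: nearW => N.
rewrite seriesEnat /=; apply: eq_big_nat => j /andP[_ jK].
by rewrite /F jK -cos2sin2 -exprM.
Qed.

(** Local central limit theorem for the symmetric binomial distribution, with
    the domination needed to sum it over a lattice of spacing [2 * K]. *)
Lemma cvg_binomial_sum :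
  (fun N => binomial_sum R (K N) (m N)) @ \oo --> gauss_series lam.
Proof.
have m_gt0 := scaling_m_gt0.
have invK := @cvg_inv_2nat R _ Koo.
pose d j N := (2 * K N * j.+1)%N.
pose F N j : R := 'C(2 * m N, m N + d j N)%:R / 'C(2 * m N, m N)%:R.
have C0 n : 0 < 'C(2 * n, n)%:R :> R by rewrite ltr0n bin_gt0; lia.
have dm j : (fun N => (d j N)%:R / (m N)%:R) @ \oo --> (0 : R).
  have H : (fun N => (2 * K N)%:R ^+ 2 / (m N)%:R *
     (j.+1%:R * (2 * K N)%:R^-1)) @ \oo --> (0 : R).
    rewrite -[X in _ --> X](mulr0 lam); apply: cvgM => //.
    by rewrite -[X in _ --> X](mulr0 (j.+1%:R)); apply: cvgMl_tmp.
  apply: cvg_trans H; apply: near_eq_cvg.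
  apply: filterS2 m_gt0 (Koo 1) => N mN kN.
  rewrite /d natrM; field.
  by rewrite !pnatr_eq0 -!lt0n; apply/andP; split => //; lia.
have d2m j : (fun N => (d j N)%:R ^+ 2 / (m N)%:R) @ \oo --> lam * j.+1%:R ^+ 2.
  have -> : (fun N => (d j N)%:R ^+ 2 / (m N)%:R) =
    (fun N => (2 * K N)%:R ^+ 2 / (m N)%:R * j.+1%:R ^+ 2 : R).
    by apply/funext => N; rewrite /d natrM exprMn mulrAC.
  exact: cvgMr_tmp.
have dom : \forall N \near \oo, forall j,
    0 <= F N j <= expR (- (lam / 4 * j.+1%:R)).
  have lam2 : lam / 2 < lam by rewrite ltr_pdivrMr // ltr_pMr // ltr1n.
  apply: filterS2 m_gt0 (cvgr_ge _ Km _ lam2) => N mN KN j.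
  rewrite /F divr_ge0 //=.
  case: (leqP (d j N) (m N)) => dmj; last first.
    by rewrite bin_small ?mul0r ?expR_ge0 //; lia.
  have mN0 : 0 < (m N)%:R :> R by rewrite ltr0n.
  rewrite ler_pdivrMr // mulrC.
  apply: (@le_trans _ _ ('C(2 * m N, m N)%:R *
      expR (- ((d j N)%:R ^+ 2 / (2 * m N)%:R)))).
    by apply: central_bin_upper; lia.
  rewrite ler_wpM2l // ler_expR lerN2.
  have -> : (d j N)%:R ^+ 2 / (2 * m N)%:R =
     (2 * K N)%:R ^+ 2 / (m N)%:R * (j.+1%:R ^+ 2 / 2) :> R.
    by rewrite /d 2!natrM; field; rewrite gt_eqF.
  apply: (@le_trans _ _ (lam / 2 * (j.+1%:R ^+ 2 / 2))).
    have -> : lam / 2 * (j.+1%:R ^+ 2 / 2) = lam / 4 * j.+1%:R ^+ 2 by field.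
    by rewrite ler_wpM2l ?divr_ge0 ?(ltW lam0) // expr2 ler_peMr ?ler0n // ler1n.
  by rewrite ler_wpM2r // divr_ge0 // exprn_ge0.
have pt j : (fun N => F N j) @ \oo --> expR (- (lam * j.+1%:R ^+ 2)).
  apply: (@squeeze_cvgr _ _ _ _
    (fun N => expR (- ((d j N)%:R ^+ 2 / (m N)%:R / (1 - (d j N)%:R / (m N)%:R))))
    (fun N => expR (- ((d j N)%:R ^+ 2 / (m N)%:R / (1 + (d j N)%:R / (m N)%:R))))).
  - apply: filterS2 m_gt0 (cvgr_lt _ (dm j) _ ltr01) => N mN dN.
    have mN0 : 0 < (m N)%:R :> R by rewrite ltr0n.
    rewrite ltr_pdivrMr // mul1r ltr_nat in dN.
    have md : (m N)%:R - (d j N)%:R = (m N - d j N)%:R :> R.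
      by rewrite natrB // ltnW.
    have md' : (m N)%:R + (d j N)%:R = (m N + d j N)%:R :> R by rewrite natrD.
    have md0 : 0 < (m N - d j N)%:R :> R by rewrite ltr0n subn_gt0.
    have md0' : 0 < (m N + d j N)%:R :> R by rewrite ltr0n; lia.
    have -> : (d j N)%:R ^+ 2 / (m N)%:R / (1 - (d j N)%:R / (m N)%:R) =
              (d j N)%:R ^+ 2 / (m N - d j N)%:R :> R.
      by rewrite -md in md0 *; field; rewrite !gt_eqF.
    have -> : (d j N)%:R ^+ 2 / (m N)%:R / (1 + (d j N)%:R / (m N)%:R) =
              (d j N)%:R ^+ 2 / (m N + d j N)%:R :> R.
      by rewrite -md' in md0' *; field; rewrite !gt_eqF.
    rewrite /F ler_pdivlMr // ler_pdivrMr //.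
    rewrite ![_ * 'C(2 * m N, m N)%:R]mulrC.
    by apply/andP; split; [apply: central_bin_lower|apply: central_bin_upper]; lia.
  - apply: continuous_cvg; first exact: continuous_expR.
    apply: cvgN; rewrite -[X in _ --> X]divr1; apply: cvgM => //.
    apply: cvgV; first exact: oner_neq0.
    by rewrite -[X in _ --> X]subr0; apply: cvgB => //; exact: cvg_cst.
  - apply: continuous_cvg; first exact: continuous_expR.
    apply: cvgN; rewrite -[X in _ --> X]divr1; apply: cvgM => //.
    apply: cvgV; first exact: oner_neq0.
    by rewrite -[X in _ --> X]addr0; apply: cvgD => //; exact: cvg_cst.
have moo k : \forall N \near \oo, (k <= m N)%N.
  have ltk : (0 : R) < (k.+1)%:R^-1 by rewrite invr_gt0.
  apply: filterS2 (Koo 1) (filterI m_gt0 (cvgr_lt _ (dm 0%N) _ ltk)).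
  move=> N K1 [m1]; rewrite ltr_pdivrMr ?ltr0n // ltr_pdivlMl ?ltr0n //.
  by rewrite -natrM ltr_nat /d; nia.
have [_ lim] := tannery (cvg_series_exp_neg (divr_gt0 lam0 (ltr0n R 4))) dom pt moo.
rewrite /gauss_series; apply: cvgD; first exact: cvg_cst.
by apply: cvgMl_tmp; apply: cvg_trans lim; apply: near_eq_cvg; apply: nearW => N.
Qed.

End scaling_limit.

Lemma cvg_gauss_series (R : realType) (lam : R) : 0 < lam ->
  cvgn (series (fun j : nat => expR (- (lam * j.+1%:R ^+ 2)))).
Proof.
move=> lam0; apply: series_le_cvg (cvg_series_exp_neg lam0) => j; rewrite ?expR_ge0 //.
by rewrite ler_expR lerN2 ler_pM2l // expr2 ler_peMr ?ler0n // ler1n.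
Qed.

Lemma gauss_series_ge1 (R : realType) (lam : R) : 0 < lam -> 1 <= gauss_series lam.
Proof.
move=> lam0; rewrite /gauss_series lerDl mulr_ge0 //.
apply: limr_ge; first exact: cvg_gauss_series.
by apply: nearW => n; apply: sumr_ge0 => j _; exact: expR_ge0.
Qed.

(** The inversion formula for the theta function of the integers between the
    points 1/4 and 4.  The discrete Poisson formula has a factor [c N]
    that compares the central binomial coefficient with [2 ^+ (2 * m)].  In the
    regime [(2 * K) ^+ 2 / m --> pi] both sums tend to [gauss_series pi], which
    is fixed by the inversion, so [c] tends to 1; replacing [K] by [2 * K]
    doubles the factor and moves the parameter to [4 * pi]. *)
Theorem gauss_series_quarter (R : realType) :
  gauss_series (pi / 4) = 2 * gauss_series (4 * pi) :> R.
Proof.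
have p0 := @pi_gt0 R.
pose K N := N.+1.
pose m N := Num.truncn ((2 * K N)%:R ^+ 2 / (pi : R)).
have Koo k : \forall N \near \oo, (k <= K N)%N.
  by exists k => // N /= kN; rewrite /K; lia.
have invK := @cvg_inv_2nat R _ Koo.
have Km : (fun N => (2 * K N)%:R ^+ 2 / (m N)%:R) @ \oo --> (pi : R).
  have H : (fun N => (m N)%:R / (2 * K N)%:R ^+ 2) @ \oo --> (pi : R)^-1.
    apply: (@squeeze_cvgr _ _ _ _ (fun N => pi^-1 - (2 * K N)%:R^-1 ^+ 2) (fun N => pi^-1)).
    - apply: nearW => N; have K0 : 0 < (2 * K N)%:R ^+ 2 :> R.
        by rewrite exprn_gt0 // ltr0n; lia.
      have := @truncn_itv R ((2 * K N)%:R ^+ 2 / pi); rewrite -/(m N) divr_ge0 ?(ltW K0) ?(ltW p0) //.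
      move=> /(_ isT) /andP[h1 h2]; apply/andP; split.
        rewrite ler_pdivlMr // mulrBl -exprMn mulVf ?expr1n; last by rewrite pnatr_eq0 /K; lia.
        by rewrite [pi^-1 * _]mulrC lerBlDr natr1 ltW.
      by rewrite ler_pdivrMr // [leRHS]mulrC.
    - rewrite -[X in _ --> X]subr0; apply: cvgB; first exact: cvg_cst.
      by rewrite -[X in _ --> X](expr0n R 2); apply: cvg_sqr.
    - exact: cvg_cst.
  have -> : (fun N => (2 * K N)%:R ^+ 2 / (m N)%:R) =
            (fun N => ((m N)%:R / (2 * K N)%:R ^+ 2)^-1 : R).
    by apply/funext => N; rewrite invf_div.
  rewrite -[X in _ --> X]invrK; apply: cvgV => //.
  by rewrite invr_eq0 gt_eqF.
(* The same m is kept while K is doubled, which multiplies the regime by 4. *)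
pose K' N := (2 * K N)%N.
have Koo' k : \forall N \near \oo, (k <= K' N)%N.
  by apply: filterS (Koo k) => N; rewrite /K'; lia.
have p4 : 0 < 4 * pi :> R by rewrite mulr_gt0.
have Km' : (fun N => (2 * K' N)%:R ^+ 2 / (m N)%:R) @ \oo --> (4 * pi : R).
  have -> : (fun N => (2 * K' N)%:R ^+ 2 / (m N)%:R) =
     (fun N => 4 * ((2 * K N)%:R ^+ 2 / (m N)%:R) : R).
    by apply/funext => N; rewrite /K' natrM exprMn; ring.
  by apply: cvgMl_tmp.
pose c N : R := (K N)%:R * (2 * 'C(2 * m N, m N)%:R / 2 ^+ (2 * m N)).
have m_gt0 := scaling_m_gt0 p0 Km.
have T1 := cvg_cosine_sum p0 Koo Km.
rewrite expr2 mulfK ?gt_eqF // in T1.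
have B1 := cvg_binomial_sum p0 Koo Km.
have T2 := cvg_cosine_sum p4 Koo' Km'.
have B2 := cvg_binomial_sum p4 Koo' Km'.
have g1 : gauss_series pi != 0 :> R.
  by rewrite gt_eqF // (lt_le_trans ltr01) // gauss_series_ge1.
have c1 : c @ \oo --> (1 : R).
  have H : (fun N => cosine_sum R (K N) (m N) / binomial_sum R (K N) (m N))
      @ \oo --> (1 : R).
    by rewrite -[X in _ --> X](divff g1); apply: cvgM => //; exact: cvgV.
  apply: cvg_trans H; apply: near_eq_cvg.
  apply: filterS m_gt0 => N mN.
  rewrite discrete_poisson // mulfK // gt_eqF // /binomial_sum.
  rewrite ltr_wpDr // mulr_ge0 // sumr_ge0 // => i _; exact: divr_ge0.
have L2 : (fun N => cosine_sum R (K' N) (m N)) @ \oo --> 2 * gauss_series (4 * pi).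
  have H : (fun N => 2 * c N * binomial_sum R (K' N) (m N)) @ \oo -->
     2 * gauss_series (4 * pi).
    rewrite -[X in X * gauss_series _]mulr1; apply: cvgM => //; exact: cvgMl_tmp.
  apply: cvg_trans H; apply: near_eq_cvg.
  apply: filterS m_gt0 => N mN.
  by rewrite [RHS]discrete_poisson //; congr (_ * _); rewrite /c /K' natrM; ring.
have quarter (q : R) : 0 < q -> q / 4 = q ^+ 2 / (4 * q).
  by move=> q0; field; rewrite gt_eqF.
rewrite quarter //.
exact: (cvg_unique (@Rhausdorff R) T2 L2).
Qed.

(** * Sums over countable types *)

Lemma esum_split2 (R : realType) (T T1 T2 : choiceType) (f : T -> \bar R)
    (e1 : T1 -> T) (e2 : T2 -> T) :
  (forall x, 0 <= f x)%E -> injective e1 -> injective e2 ->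
  (forall x y, e1 x <> e2 y) ->
  (forall z, (exists x, z = e1 x) \/ (exists y, z = e2 y)) ->
  (\esum_(z in [set: T]) f z =
   \esum_(x in [set: T1]) f (e1 x) + \esum_(y in [set: T2]) f (e2 y))%E.
Proof.
move=> f0 i1 i2 disj cov.
rewrite (esumID (range e1)) // !setTI; congr (_ + _)%E.
  by rewrite esum_image // => x y _ _; exact: i1.
have -> : ~` range e1 = range e2.
  apply/seteqP; split=> z /=.
    by move=> h; case: (cov z) => -[x e]; [case: h|]; exists x.
  by move=> [y _ <-] [x _ e]; exact: disj e.
by rewrite esum_image // => x y _ _; exact: i2.
Qed.

Lemma reindex_esumT (R : realType) (T T' : choiceType) (e : T -> T') (e' : T' -> T)
    (a : T' -> \bar R) : cancel e e' -> cancel e' e ->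
  (\esum_(y in [set: T']) a y = \esum_(x in [set: T]) a (e x))%E.
Proof.
move=> ee' e'e; apply: reindex_esum; split => //.
- by move=> x y _ _; exact: can_inj ee' _ _.
- by move=> y _ /=; exists (e' y).
Qed.

Lemma esumZl (R : realType) (T : choiceType) (D : set T) (c : R)
    (f : T -> \bar R) : 0 <= c -> (forall x, 0 <= f x)%E ->
  (\esum_(x in D) (c%:E * f x) = c%:E * \esum_(x in D) f x)%E.
Proof.
move=> c0 f0.
have le (d : R) (g : T -> \bar R) : 0 <= d -> (forall x, 0 <= g x)%E ->
    (\esum_(x in D) (d%:E * g x) <= d%:E * \esum_(x in D) g x)%E.
  move=> d0 g0; apply: ge_ereal_sup => /= _ [X [finX XD]] <-.
  rewrite fsbig_finite //= -ge0_sume_distrr; last by move=> i _; exact: g0.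
  apply: lee_wpmul2l; first by rewrite lee_fin.
  by apply: ereal_sup_ubound; exists X => //; rewrite fsbig_finite.
move: c0; rewrite le_eqVlt => /predU1P[<-|c0].
  by rewrite mul0e esum1 // => x _; rewrite mul0e.
apply/eqP; rewrite eq_le le ?(ltW c0) //=.
have := @le c^-1 (fun x => c%:E * f x)%E.
rewrite invr_ge0 (ltW c0) => /(_ isT) h.
have {h} : (\esum_(x in D) f x <= c^-1%:E * \esum_(x in D) (c%:E * f x))%E.
  apply: le_trans (h _); last by move=> x; rewrite mule_ge0 // lee_fin ltW.
  by apply: le_esum => x _; rewrite muleA -EFinM mulVf ?gt_eqF // mul1e.
by rewrite muleC lee_pdivlMr // muleC.
Qed.

Lemma esum_prod (R : realType) (T1 T2 : choiceType) (f : T1 -> R) (g : T2 -> R)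
    (a b : R) : (forall x, 0 <= f x) -> (forall y, 0 <= g y) ->
  (\esum_(x in [set: T1]) (f x)%:E = a%:E)%E ->
  (\esum_(y in [set: T2]) (g y)%:E = b%:E)%E ->
  (\esum_(p in [set: T1 * T2]) (f p.1 * g p.2)%:E = (a * b)%:E)%E.
Proof.
move=> f0 g0 fa gb.
have <- : [set: T1] `*`` (fun=> [set: T2]) = [set: T1 * T2].
  by apply/seteqP; split.
rewrite -(@esum_esum R T1 T2 setT (fun=> setT) (fun x y => (f x * g y)%:E)); last first.
  by move=> x y _ _; rewrite lee_fin mulr_ge0.
have b0 : 0 <= b by rewrite -lee_fin -gb; apply: esum_ge0 => y _; rewrite lee_fin.
transitivity (\esum_(x in [set: T1]) (b%:E * (f x)%:E))%E.
  apply: eq_esum => x _; rewrite muleC -gb -esumZl //.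
by rewrite esumZl ?fa -?EFinM 1?mulrC // => x; rewrite lee_fin.
Qed.

(** Fubini for a finite number of factors: peel off the first coordinate. *)
Lemma esum_rV_prod (R : realType) (n : nat)
    (g : 'I_n -> int -> R) (S : 'I_n -> R) :
  (forall i x, 0 <= g i x) ->
  (forall i, (\esum_(x in [set: int]) (g i x)%:E = (S i)%:E)%E) ->
  (\esum_(z in [set: 'rV[int]_n]) (\prod_i g i (z 0 i))%:E = (\prod_i S i)%:E)%E.
Proof.
elim: n g S => [|n IH] g S g0 gS.
  rewrite big_ord0.
  have -> : [set: 'rV[int]_0] = [set 0].
    by apply/seteqP; split => // v _ /=; apply/rowP => -[].
  by rewrite esum_set1 big_ord0 // lee_fin.
pose e (p : int * 'rV[int]_n) : 'rV[int]_n.+1 :=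
  \row_i (if unlift ord0 i is Some j then p.2 0 j else p.1).
pose e' (v : 'rV[int]_n.+1) : int * 'rV[int]_n := (v 0 ord0, \row_j v 0 (lift ord0 j)).
rewrite (@reindex_esumT _ _ _ e e'); last 2 first.
- move=> [x v]; rewrite /e' /e /= !mxE unlift_none; congr pair.
  by apply/rowP => j; rewrite !mxE liftK.
- move=> v; apply/rowP => i; rewrite /e mxE /=; case: unliftP => [j ->|->] //.
  by rewrite mxE.
rewrite big_ord_recl -(@esum_prod R int 'rV[int]_n (g ord0)
   (fun v => \prod_i g (lift ord0 i) (v 0 i))) //.
- apply: eq_esum => -[x v] _ /=; congr EFin.
  rewrite big_ord_recl /e mxE unlift_none /=; congr (_ * _).
  by apply: eq_bigr => i _; rewrite mxE liftK.
- by move=> v; apply: prodr_ge0.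
- by apply: (IH (fun i => g (lift ord0 i)) (fun i => S (lift ord0 i))).
Qed.

(** * The theta constants of the integers and of the shifted integers *)

(** A term of the theta series of the shifted lattice [s + Z]. *)
Definition gauss_term (R : realType) (s tau : R) (z : int) : R :=
  expR (- pi * tau * (z%:~R + s) ^+ 2).

(** The Jacobi theta constants at [i * tau], as unconditional sums of
    nonnegative terms.  The square of theta4 is a combination of these two at
    [2 * tau], which keeps all the sums free of signs. *)
Definition theta3 (R : realType) (tau : R) : R :=
  fine (\esum_(z in [set: int]) (gauss_term 0 tau z)%:E)%E.

Definition theta2 (R : realType) (tau : R) : R :=
  fine (\esum_(z in [set: int]) (gauss_term 2^-1 tau z)%:E)%E.

Lemma gauss_term_ge0 (R : realType) (s tau : R) (z : int) : 0 <= gauss_term s tau z.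
Proof. exact: expR_ge0. Qed.

Lemma gauss_termE_ge0 (R : realType) (s tau : R) (z : int) :
  (0 <= (gauss_term s tau z)%:E)%E.
Proof. by rewrite lee_fin gauss_term_ge0. Qed.

Lemma nneseries_EFin (R : realType) (u : nat -> R) : (forall n, 0 <= u n) ->
  cvgn (series u) ->
  (\esum_(n in [set: nat]) (u n)%:E = (limn (series u))%:E)%E.
Proof.
move=> u0 cu; rewrite -nneseries_esumT //.
rewrite -EFin_lim //; congr (lim (_ @ \oo)).
by apply/funext => n; rewrite /= sumEFin.
Qed.

Lemma esum_gauss_term0 (R : realType) (tau : R) : 0 < tau ->
  (\esum_(z in [set: int]) (gauss_term 0 tau z)%:E =
   (gauss_series (pi * tau))%:E)%E.
Proof.
move=> tau0.
have lam0 : 0 < pi * tau :> R by rewrite mulr_gt0 ?pi_gt0.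
have E0 z : (0 <= (gauss_term 0 tau z)%:E)%E by exact: gauss_termE_ge0.
pose u (j : nat) : R := expR (- (pi * tau * j.+1%:R ^+ 2)).
have u0 j : 0 <= u j by exact: expR_ge0.
have cu : cvgn (series u) by exact: cvg_gauss_series.
rewrite (@esum_split2 R int nat nat _ Posz Negz); last 5 first.
- by [].
- by move=> x y [].
- by move=> x y [].
- by [].
- by move=> [n|n]; [left|right]; exists n.
rewrite (@esum_split2 R nat unit nat _ (fun=> 0%N) succn); last 5 first.
- by [].
- by move=> [] [].
- by move=> x y [].
- by [].
- by move=> [|n]; [left; exists tt|right; exists n].
have -> : [set: unit] = [set tt] by apply/seteqP; split => // -[].
rewrite esum_set1 //.
have -> : (\esum_(y in [set: nat]) (gauss_term 0 tau (Posz y.+1))%:E =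
          (limn (series u))%:E)%E.
  rewrite -nneseries_EFin //; apply: eq_esum => j _.
  by rewrite /gauss_term /u addr0 !mulNr.
have -> : (\esum_(y in [set: nat]) (gauss_term 0 tau (Negz y))%:E =
          (limn (series u))%:E)%E.
  rewrite -nneseries_EFin //; apply: eq_esum => j _.
  by rewrite /gauss_term /u addr0 !mulNr NegzE mulrNz sqrrN.
rewrite /gauss_term addr0 expr0n mulr0 expR0 -!EFinD; congr EFin.
by rewrite /gauss_series -/u; ring.
Qed.

Lemma theta3E (R : realType) (tau : R) : 0 < tau ->
  theta3 tau = gauss_series (pi * tau).
Proof. by move=> tau0; rewrite /theta3 esum_gauss_term0. Qed.

Lemma esum_gauss_term_quarter (R : realType) (tau : R) :
  (\esum_(z in [set: int]) (gauss_term 0 tau z)%:E =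
   \esum_(z in [set: int]) (gauss_term 0 (4 * tau) z)%:E +
   \esum_(z in [set: int]) (gauss_term 2^-1 (4 * tau) z)%:E)%E.
Proof.
rewrite (@esum_split2 R int int int _ (fun z => 2 * z) (fun z => 2 * z + 1)).
- congr (_ + _)%E; apply: eq_esum => z _; congr EFin; congr expR.
    by rewrite !addr0 intrM; ring.
  by rewrite addr0 intrD intrM; field.
- by move=> z; exact: gauss_termE_ge0.
- by move=> x y; lia.
- by move=> x y; lia.
- by move=> x y; lia.
- move=> z; have [h|h] : (z = 2 * (z %/ 2)%Z \/ z = 2 * (z %/ 2)%Z + 1) by lia.
    by left; exists (z %/ 2)%Z.
  by right; exists (z %/ 2)%Z.
Qed.

(** Finiteness over the half-integers: they are part of the integers after
    multiplication by 2. *)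
Lemma esum_gauss_term_fin (R : realType) (tau : R) : 0 < tau ->
  (\esum_(z in [set: int]) (gauss_term 0 tau z)%:E = (theta3 tau)%:E)%E /\
  (\esum_(z in [set: int]) (gauss_term 2^-1 tau z)%:E = (theta2 tau)%:E)%E.
Proof.
move=> tau0; rewrite /theta3 /theta2 esum_gauss_term0 //; split => //.
rewrite fineK //; rewrite ge0_fin_numE; last by apply: esum_ge0 => z _; exact: gauss_termE_ge0.
have tau4 : 0 < tau / 4 by rewrite divr_gt0.
apply: (@le_lt_trans _ _ (gauss_series (pi * (tau / 4)))%:E); last exact: ltry.
rewrite -esum_gauss_term0 // esum_gauss_term_quarter.
have -> : 4 * (tau / 4) = tau by field.
by apply: leeDr; apply: esum_ge0 => z _; exact: gauss_termE_ge0.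
Qed.

Lemma theta3_split (R : realType) (tau : R) : 0 < tau ->
  theta3 tau = theta3 (4 * tau) + theta2 (4 * tau).
Proof.
move=> tau0; have tau4 : 0 < 4 * tau by rewrite mulr_gt0.
have := esum_gauss_term_quarter tau.
have [-> _] := esum_gauss_term_fin tau0.
have [-> ->] := esum_gauss_term_fin tau4.
by move=> [].
Qed.

(** The pairs of integers of even sum form the image of Z^2 under a rotation
    by 45 degrees followed by a dilation; those of odd sum form a translate
    of it. *)
Lemma esum_rotate (R : realType) (F : int * int -> R) : (forall p, 0 <= F p) ->
  (\esum_(p in [set: int * int]) (F p)%:E =
   \esum_(q in [set: int * int]) (F (q.1 + q.2, q.1 - q.2))%:E +
   \esum_(q in [set: int * int]) (F (q.1 + q.2 + 1, q.1 - q.2))%:E)%E.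
Proof.
move=> F0.
rewrite (@esum_split2 R _ (int * int)%type (int * int)%type _ (fun q => (q.1 + q.2, q.1 - q.2))
   (fun q => (q.1 + q.2 + 1, q.1 - q.2))) //.
- by move=> [x1 x2] [y1 y2] /= [h1 h2]; congr pair; lia.
- by move=> [x1 x2] [y1 y2] /= [h1 h2]; congr pair; lia.
- by move=> [x1 x2] [y1 y2] /= [h1 h2]; lia.
- move=> [a b] /=.
  have [h|h] : ((a + b = 2 * ((a + b) %/ 2)%Z) \/ (a + b = 2 * ((a + b) %/ 2)%Z + 1)) by lia.
    left; exists (((a + b) %/ 2)%Z, a - ((a + b) %/ 2)%Z) => /=; congr pair; lia.
  right; exists (((a + b) %/ 2)%Z, a - 1 - ((a + b) %/ 2)%Z) => /=; congr pair; lia.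
Qed.

(** The rotation doubles the quadratic form [x ^+ 2 + y ^+ 2]; the odd class
    is centred at [(1/2, 1/2)]. *)
Lemma theta3_sqr (R : realType) (tau : R) : 0 < tau ->
  theta3 tau ^+ 2 = theta3 (2 * tau) ^+ 2 + theta2 (2 * tau) ^+ 2.
Proof.
move=> tau0; have tau2 : 0 < 2 * tau by rewrite mulr_gt0.
have [h3 h2] := esum_gauss_term_fin tau0.
have [k3 k2] := esum_gauss_term_fin tau2.
have e1 := esum_prod (gauss_term_ge0 0 tau) (gauss_term_ge0 0 tau) h3 h3.
rewrite esum_rotate in e1; last by move=> p; rewrite mulr_ge0 ?gauss_term_ge0.
have e2 := esum_prod (gauss_term_ge0 0 (2 * tau)) (gauss_term_ge0 0 (2 * tau)) k3 k3.
have e3 := esum_prod (gauss_term_ge0 2^-1 (2 * tau)) (gauss_term_ge0 2^-1 (2 * tau)) k2 k2.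
apply: EFin_inj; rewrite !expr2 EFinD -e1 -e2 -e3.
congr (_ + _)%E; apply: eq_esum => -[x y] _ /=; congr EFin.
  by rewrite /gauss_term -!expRD; congr expR; rewrite !addr0 rmorphD rmorphB /=; ring.
by rewrite /gauss_term -!expRD; congr expR; rewrite !addr0 !rmorphD rmorphN /=; field.
Qed.

(** As for [theta3_sqr], but the centre [(1/2, 1/2)] of the summation is
    rotated to a point with one integral and one half-integral coordinate. *)
Lemma theta2_sqr (R : realType) (tau : R) : 0 < tau ->
  theta2 tau ^+ 2 = 2 * (theta3 (2 * tau) * theta2 (2 * tau)).
Proof.
move=> tau0; have tau2 : 0 < 2 * tau by rewrite mulr_gt0.
have [h3 h2] := esum_gauss_term_fin tau0.
have [k3 k2] := esum_gauss_term_fin tau2.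
have e1 := esum_prod (gauss_term_ge0 2^-1 tau) (gauss_term_ge0 2^-1 tau) h2 h2.
rewrite esum_rotate in e1; last by move=> p; rewrite mulr_ge0 ?gauss_term_ge0.
have e2 := esum_prod (gauss_term_ge0 2^-1 (2 * tau)) (gauss_term_ge0 0 (2 * tau)) k2 k3.
have e3 := esum_prod (gauss_term_ge0 0 (2 * tau)) (gauss_term_ge0 2^-1 (2 * tau)) k3 k2.
apply: EFin_inj; rewrite expr2 mulr2n mulrDl mul1r.
rewrite EFinD -e1 [X in (_ = X%:E + _)%E]mulrC -e2 -e3.
congr (_ + _)%E.
  apply: eq_esum => -[x y] _ /=; congr EFin.
  by rewrite /gauss_term -!expRD; congr expR; rewrite !addr0 !rmorphD rmorphN /=; field.
rewrite [RHS](@reindex_esumT _ _ _ (fun q : int * int => (q.1 + 1, q.2)) (fun q => (q.1 - 1, q.2))).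
- apply: eq_esum => -[x y] _ /=; congr EFin.
  by rewrite /gauss_term -!expRD; congr expR; rewrite !addr0 !rmorphD rmorphN /=; field.
- by move=> [x y] /=; rewrite addrK.
- by move=> [x y] /=; rewrite subrK.
Qed.

Lemma theta3_ge1 (R : realType) (tau : R) : 0 < tau -> 1 <= theta3 tau.
Proof. by move=> tau0; rewrite theta3E // gauss_series_ge1 // mulr_gt0 ?pi_gt0. Qed.

Lemma theta3_gt0 (R : realType) (tau : R) : 0 < tau -> 0 < theta3 tau.
Proof. by move=> /theta3_ge1; exact: lt_le_trans. Qed.

Lemma theta2_lower (R : realType) (tau : R) : 0 < tau ->
  expR (- (pi * tau / 4)) <= theta2 tau.
Proof.
move=> tau0; have [_ h2] := esum_gauss_term_fin tau0.
rewrite -lee_fin -h2; apply: esum_ge; exists [set 0].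
  by split => //; exact: finite_set1.
rewrite fsbig_set1 lee_fin /gauss_term le_eqVlt; apply/orP; left; apply/eqP.
by congr expR; rewrite add0r; field.
Qed.

Lemma theta2_gt0 (R : realType) (tau : R) : 0 < tau -> 0 < theta2 tau.
Proof. by move=> /theta2_lower; apply: lt_le_trans; exact: expR_gt0. Qed.

(** Every half-integer has square at least 1/4. *)
Lemma theta2_decay (R : realType) (tau sig : R) : 0 < tau -> tau <= sig ->
  theta2 sig <= expR (- (pi * (sig - tau) / 4)) * theta2 tau.
Proof.
move=> tau0 ts; have sig0 := lt_le_trans tau0 ts.
have [_ h2] := esum_gauss_term_fin tau0.
have [_ k2] := esum_gauss_term_fin sig0.
rewrite -lee_fin EFinM -h2 -k2 -esumZl ?expR_ge0 //; last first.
  by move=> z; exact: gauss_termE_ge0.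
apply: le_esum => z _; rewrite -EFinM lee_fin /gauss_term -expRD ler_expR.
have z4 : 4^-1 <= (z%:~R + 2^-1) ^+ 2 :> R.
  have -> : (z%:~R + 2^-1) ^+ 2 = (z * (z + 1))%:~R + 4^-1 :> R.
    by rewrite intrM intrD; field.
  by rewrite lerDr ler0z; nia.
rewrite -subr_ge0.
have -> : - (pi * (sig - tau) / 4) + - pi * tau * (z%:~R + 2^-1) ^+ 2 -
    - pi * sig * (z%:~R + 2^-1) ^+ 2 =
    pi * ((sig - tau) * ((z%:~R + 2^-1) ^+ 2 - 4^-1)) :> R by ring.
by rewrite mulr_ge0 ?pi_ge0 // mulr_ge0 ?subr_ge0.
Qed.

Lemma theta3_nonincreasing (R : realType) (tau sig : R) : 0 < tau -> tau <= sig ->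
  theta3 sig <= theta3 tau.
Proof.
move=> tau0 ts; have sig0 := lt_le_trans tau0 ts.
have [h3 _] := esum_gauss_term_fin tau0.
have [k3 _] := esum_gauss_term_fin sig0.
rewrite -lee_fin -h3 -k3; apply: le_esum => z _.
rewrite lee_fin ler_expR !mulNr lerN2 ler_wpM2r ?sqr_ge0 //.
by rewrite ler_wpM2l ?pi_ge0.
Qed.

(** Both sides are the square of theta4 at [tau / 2]; the form on the right
    shows that the difference on the left is nonnegative. *)
Lemma theta_sqr_sub (R : realType) (tau : R) : 0 < tau ->
  theta3 tau ^+ 2 - theta2 tau ^+ 2 = (theta3 (2 * tau) - theta2 (2 * tau)) ^+ 2.
Proof. by move=> tau0; rewrite (theta3_sqr tau0) (theta2_sqr tau0); ring. Qed.

Lemma theta2_le_theta3 (R : realType) (tau : R) : 0 < tau -> theta2 tau <= theta3 tau.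
Proof.
move=> tau0; have p0 := theta3_gt0 tau0; have b0 := theta2_gt0 tau0.
rewrite -(@ler_pXn2r _ 2) ?nnegrE ?(ltW p0) ?(ltW b0) //.
by rewrite -subr_ge0 theta_sqr_sub // sqr_ge0.
Qed.

(** Self-duality at [tau = 1] (the equality of theta2 and theta4), read off
    from the inversion formula between 1/4 and 4 and the parity splitting. *)
Lemma theta2_1 (R : realType) : theta2 1 = theta3 4 - theta2 4 :> R.
Proof.
have e4 : 4 * 4^-1 = 1 :> R by field.
have q0 : 0 < 4^-1 :> R by rewrite invr_gt0.
have s1 := theta3_split q0; rewrite e4 in s1.
have s2 := theta3_split (@ltr01 R); rewrite mulr1 in s2.
have := gauss_series_quarter R; rewrite -(theta3E q0) [4 * pi]mulrC -theta3E //.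
lra.
Qed.

(** This says that the elliptic modulus at the square lattice is 1 / sqrt 2. *)
Lemma theta_lemniscatic (R : realType) : theta3 1 ^+ 4 = 2 * theta2 1 ^+ 4 :> R.
Proof.
have s2 := theta3_split (@ltr01 R); rewrite mulr1 in s2.
have h1 := theta_sqr_sub (@ltr01 R); rewrite mulr1 in h1.
have h2 : theta3 2 ^+ 2 - theta2 2 ^+ 2 = theta2 1 ^+ 2 :> R.
  rewrite theta_sqr_sub // theta2_1; congr ((theta3 _ - theta2 _) ^+ 2); ring.
have k1 := theta3_sqr (@ltr01 R); rewrite mulr1 in k1.
have k2 := theta2_sqr (@ltr01 R); rewrite mulr1 in k2.
rewrite (exprM _ 2 2) k1 [in RHS](exprM _ 2 2) mulr2n mulrDl mul1r -{1}h2 k2; ring.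
Qed.

(** The quotient [x] at [tau] and [y] at [2 * tau] satisfy
    [x ^+ 2 = 2 * y / (1 + y ^+ 2)] (a Landen transformation), and the right-hand
    side is injective in [y] on [0, 1]. *)
Lemma theta_ratio_duplication (R : realType) (tau sig : R) :
  0 < tau -> 0 < sig ->
  theta2 tau / theta3 tau = theta2 sig / theta3 sig ->
  theta2 (2 * tau) / theta3 (2 * tau) = theta2 (2 * sig) / theta3 (2 * sig).
Proof.
have half (r : R) : 0 < r -> (theta2 r / theta3 r) ^+ 2 =
    2 * (theta2 (2 * r) / theta3 (2 * r)) /
    (1 + (theta2 (2 * r) / theta3 (2 * r)) ^+ 2).
  move=> r0; have r2 : 0 < 2 * r by rewrite mulr_gt0.
  rewrite expr_div_n (theta2_sqr r0) (theta3_sqr r0).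
  have p0 := theta3_gt0 r2; have b0 := theta2_gt0 r2.
  field; rewrite gt_eqF //= gt_eqF //.
  by rewrite ltr_wpDr ?exprn_gt0 ?exprn_ge0 ?ltW.
have range (r : R) : 0 < r -> 0 < theta2 (2 * r) / theta3 (2 * r) <= 1.
  move=> r0; have r2 : 0 < 2 * r by rewrite mulr_gt0.
  rewrite (divr_gt0 (theta2_gt0 r2) (theta3_gt0 r2)) /=.
  rewrite (ler_pdivrMr _ _ (theta3_gt0 r2)).
  by rewrite mul1r theta2_le_theta3.
move=> t0 s0 /(congr1 (fun y => y ^+ 2)); rewrite (half _ t0) (half _ s0).
have := range _ t0; have := range _ s0.
move: (theta2 (2 * tau) / _) (theta2 (2 * sig) / _) => x y.
move=> /andP[y0 y1] /andP[x0 x1] /eqP.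
have dx : 1 + x ^+ 2 != 0 by rewrite gt_eqF // ltr_wpDr ?sqr_ge0.
have dy : 1 + y ^+ 2 != 0 by rewrite gt_eqF // ltr_wpDr ?sqr_ge0.
rewrite eqr_div // => /eqP e.
have /eqP : (x - y) * (1 - x * y) = 0 by lra.
rewrite mulf_eq0 => /orP[|] /eqP h; first by lra.
have : 1 <= x * y by lra.
nra.
Qed.

(** Propagate the equality to [2 ^+ j * tau] and [2 ^+ j * sig]: the quotient
    is at least [expR (- pi * 2 ^+ j * tau / 4)] at the former and at most
    [expR (- pi * 2 ^+ j * sig / 4)] at the latter, up to constants. *)
Lemma theta_ratio_neq (R : realType) (tau sig : R) : 0 < tau -> tau < sig ->
  theta2 tau / theta3 tau != theta2 sig / theta3 sig.
Proof.
move=> tau0 ts; apply/eqP => e; have sig0 := lt_trans tau0 ts.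
have pow (j : nat) : theta2 (2 ^+ j * tau) / theta3 (2 ^+ j * tau) =
    theta2 (2 ^+ j * sig) / theta3 (2 ^+ j * sig).
  elim: j => [|j IH]; first by rewrite expr0 !mul1r.
  rewrite exprS -!mulrA; apply: theta_ratio_duplication => //.
    by rewrite mulr_gt0 // exprn_gt0.
  by rewrite mulr_gt0 // exprn_gt0.
pose d : R := pi * (sig - tau) / 4.
have d0 : 0 < d by rewrite divr_gt0 // mulr_gt0 ?pi_gt0 // subr_gt0.
(* M collects the factors of the two bounds that do not depend on j. *)
pose M : R := theta3 tau * (expR (pi * sig / 4) * theta2 sig).
have bnd (j : nat) : expR (2 ^+ j * d) <= M.
  have j1 : 1 <= 2 ^+ j :> R by rewrite exprn_ege1 // ler1n.
  have jt0 : 0 < 2 ^+ j * tau by rewrite mulr_gt0 // exprn_gt0.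
  have js0 : 0 < 2 ^+ j * sig by rewrite mulr_gt0 // exprn_gt0.
  have jt : tau <= 2 ^+ j * tau by rewrite ler_peMl // ltW.
  have js : sig <= 2 ^+ j * sig by rewrite ler_peMl // ltW.
  have lo : expR (- (pi * (2 ^+ j * tau) / 4)) / theta3 tau <=
      theta2 (2 ^+ j * tau) / theta3 (2 ^+ j * tau).
    apply: ler_pM; rewrite ?expR_ge0 ?invr_ge0 ?(ltW (theta3_gt0 tau0)) //.
      exact: theta2_lower.
    rewrite lef_pV2 ?posrE; [|exact: theta3_gt0|exact: theta3_gt0].
    exact: theta3_nonincreasing.
  have up : theta2 (2 ^+ j * sig) / theta3 (2 ^+ j * sig) <=
      expR (- (pi * (2 ^+ j * sig - sig) / 4)) * theta2 sig.
    apply: le_trans (theta2_decay sig0 js).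
    rewrite (ler_pdivrMr _ _ (theta3_gt0 js0)) ler_peMr //.
      exact/ltW/theta2_gt0.
    exact: theta3_ge1.
  have {lo up} h := le_trans lo (le_trans (_ : _ <= _) up).
  have {h} := h _; rewrite pow => /(_ (lexx _)).
  rewrite (ler_pdivrMr _ _ (theta3_gt0 tau0)).
  rewrite -(ler_pM2r (expR_gt0 (pi * (2 ^+ j * sig) / 4))).
  rewrite -expRD => h; apply: le_trans (le_trans h _).
    by rewrite ler_expR le_eqVlt; apply/orP; left; apply/eqP; rewrite /d; ring.
  rewrite /M mulrAC [X in _ <= X]mulrC ler_wpM2r ?(ltW (theta3_gt0 tau0)) //.
  rewrite mulrAC -expRD ler_wpM2r ?(ltW (theta2_gt0 sig0)) //.
  by rewrite ler_expR le_eqVlt; apply/orP; left; apply/eqP; ring.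
have [j jM] : exists j : nat, M / d < j%:R.
  have M0 : 0 <= M / d.
    rewrite divr_ge0 ?(ltW d0) // /M mulr_ge0 ?mulr_ge0 ?expR_ge0 //.
      exact/ltW/theta3_gt0.
    exact/ltW/theta2_gt0.
  by exists (Num.bound (M / d)); exact: archi_boundP.
have := le_trans (expR_ge1Dx (2 ^+ j * d)) (bnd j).
have : j%:R * d <= 2 ^+ j * d.
  by rewrite ler_wpM2r ?(ltW d0) // -natrX ler_nat ltnW // ltn_expl.
rewrite ltr_pdivrMr // in jM; lra.
Qed.

(** This is [theta4 ^+ 2 / theta3 ^+ 2] at [tau]: the numerator is the
    expression of [theta4 tau ^+ 2] by the duplication formulas. *)
Definition theta_modulus (R : realType) (tau : R) : R :=
  (theta3 (2 * tau) ^+ 2 - theta2 (2 * tau) ^+ 2) / theta3 tau ^+ 2.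

Lemma theta_modulusD1 (R : realType) (tau : R) : 0 < tau ->
  1 + theta_modulus tau = 2 * (theta3 (2 * tau) / theta3 tau) ^+ 2.
Proof.
move=> tau0; have p0 := theta3_gt0 tau0.
have e : theta3 (2 * tau) ^+ 2 = theta3 tau ^+ 2 - theta2 (2 * tau) ^+ 2.
  by rewrite (theta3_sqr tau0) addrK.
by rewrite /theta_modulus expr_div_n e; field; rewrite gt_eqF.
Qed.

Lemma theta_modulusB1 (R : realType) (tau : R) : 0 < tau ->
  1 - theta_modulus tau = 2 * (theta2 (2 * tau) / theta3 tau) ^+ 2.
Proof.
move=> tau0; have p0 := theta3_gt0 tau0.
have e : theta3 (2 * tau) ^+ 2 = theta3 tau ^+ 2 - theta2 (2 * tau) ^+ 2.
  by rewrite (theta3_sqr tau0) addrK.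
by rewrite /theta_modulus expr_div_n e; field; rewrite gt_eqF.
Qed.

Lemma theta_modulus_range (R : realType) (tau : R) : 0 < tau ->
  0 <= theta_modulus tau <= 1.
Proof.
move=> tau0; have tau2 : 0 < 2 * tau by rewrite mulr_gt0.
apply/andP; split.
  by rewrite /theta_modulus theta_sqr_sub // divr_ge0 ?sqr_ge0.
by rewrite -subr_ge0 theta_modulusB1 // mulr_ge0 ?sqr_ge0.
Qed.

(** Jacobi's identity [theta3 ^+ 4 = theta2 ^+ 4 + theta4 ^+ 4]. *)
Lemma theta_modulus_sqr (R : realType) (tau : R) : 0 < tau ->
  theta_modulus tau ^+ 2 = 1 - (theta2 tau / theta3 tau) ^+ 4.
Proof.
move=> tau0; have p0 := theta3_gt0 tau0; have p0' : theta3 tau != 0 by rewrite gt_eqF.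
have -> : (theta2 tau / theta3 tau) ^+ 4 = (theta2 tau ^+ 2 / theta3 tau ^+ 2) ^+ 2.
  by field.
have : theta3 tau ^+ 2 != 0 by rewrite expf_neq0.
by rewrite /theta_modulus (theta2_sqr tau0) (theta3_sqr tau0) => pb; field.
Qed.

Lemma theta_modulus_half (R : realType) (tau : R) : 0 < tau ->
  (theta_modulus tau ^+ 2 == 2^-1) = (tau == 1).
Proof.
move=> tau0.
have e1 : theta_modulus 1 ^+ 2 = 2^-1 :> R.
  rewrite theta_modulus_sqr // expr_div_n theta_lemniscatic.
  have := theta2_gt0 (@ltr01 R) => b0; field.
  by rewrite gt_eqF.
apply/eqP/eqP => [|-> //].
rewrite -e1 !theta_modulus_sqr // => /addrI /oppr_inj h.
have ratio_ge0 (r : R) : 0 < r -> 0 <= theta2 r / theta3 r.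
  by move=> r0; apply: divr_ge0; apply/ltW; [exact: theta2_gt0|exact: theta3_gt0].
have {}h : theta2 tau / theta3 tau = theta2 1 / theta3 1.
  apply/eqP; rewrite -(@eqrXn2 _ 4) ?ratio_ge0 //; exact/eqP.
case: (ltgtP tau 1) => // l.
  by have := theta_ratio_neq tau0 l; rewrite h eqxx.
by have := theta_ratio_neq ltr01 l; rewrite h eqxx.
Qed.

(** * Theta series of Construction A lattices *)

Lemma F2_cases (b : 'F_2) : b = 0 \/ b = 1.
Proof. by case: b => -[|[|m]] h //; [left|right]; exact/val_inj. Qed.

Lemma theta_series_int_lattice (R : realType) (n : nat) (tau : R) : 0 < tau ->
  theta_series (int_lattice R n) tau = (theta3 tau ^+ n)%:E.
Proof.
move=> tau0; have [h3 _] := esum_gauss_term_fin tau0.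
rewrite /theta_series /int_lattice esum_image; last first.
  move=> u v _ _ /matrixP e; apply/matrixP => i j.
  by have := e i j; rewrite !mxE => /intr_inj.
have -> : theta3 tau ^+ n = \prod_(i < n) theta3 tau by rewrite prodr_const card_ord.
rewrite -(@esum_rV_prod R n (fun=> gauss_term 0 tau)) //; last first.
  by move=> i x; exact: gauss_term_ge0.
apply: eq_esum => z _; congr EFin; rewrite -expR_sum; congr expR.
by rewrite /sqnorm mulr_sumr; apply: eq_bigr => i _; rewrite mxE addr0.
Qed.

Lemma esum_vspace (R : realType) (n : nat) (C : {vspace 'rV['F_2]_n})
    (F : 'rV['F_2]_n -> \bar R) : (forall c, 0 <= F c)%E ->
  (\esum_(c in [set c | c \in C]) F c = \sum_(c | c \in C) F c)%E.
Proof.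
move=> F0; rewrite esum_fset //.
rewrite [RHS](@bigfs _ _ _ _ (index_enum _) (mem C)) ?index_enum_uniq //.
by move=> c _; rewrite mem_index_enum.
Qed.

(** A point of the lattice determines its codeword through the parity of
    its coordinates, so the sum splits over the code.  On the class of a
    codeword it factors over the coordinates:
    [(b + 2 * z) ^+ 2 / 2 = 2 * (z + b / 2) ^+ 2] for a bit [b]. *)
Lemma theta_series_constructionA (R : realType) (n : nat)
    (C : {vspace 'rV['F_2]_n}) (tau : R) : 0 < tau ->
  theta_series (constructionA R C) tau =
  (weight_enum C (theta3 (2 * tau)) (theta2 (2 * tau)))%:E.
Proof.
move=> tau0; have tau2 : 0 < 2 * tau by rewrite mulr_gt0.
have [h3 h2] := esum_gauss_term_fin tau2.
pose v (p : 'rV['F_2]_n * 'rV[int]_n) : 'rV[R]_n :=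
  (Num.sqrt 2)^-1 *: (lift01 R p.1 + 2 *: map_mx intr p.2).
have s2 : Num.sqrt 2 != 0 :> R by rewrite gt_eqF // sqrtr_gt0.
have -> : constructionA R C = v @` ([set c | c \in C] `*`` (fun=> [set: 'rV[int]_n])).
  apply/seteqP; split => x /=.
    by move=> [c cC [_ [z _ <-]] <-]; exists (c, z).
  by move=> [[c z] [/= cC _] <-]; exists c => //; exists (map_mx intr z) => //; exists z.
rewrite /theta_series esum_image; last first.
  move=> [c z] [c' z'] _ _; rewrite /v /= => e.
  have {}e : lift01 R c + 2 *: map_mx intr z = lift01 R c' + 2 *: map_mx intr z'.
    by apply: (scalerI _ e); rewrite invr_eq0.
  have ei i : (c 0 i : nat)%:Z + 2 * z 0 i = (c' 0 i : nat)%:Z + 2 * z' 0 i.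
    have /matrixP /(_ 0 i) := e; rewrite !mxE => {}e.
    by apply: (@intr_inj R); rewrite !intrD !intrM.
  have cc : c = c'.
    apply/rowP => i; have := ei i.
    have ci : (c 0%R i < 2)%N by exact: ltn_ord.
    have ci' : (c' 0%R i < 2)%N by exact: ltn_ord.
    suff h : forall (a b : nat) (x y : int), (a < 2)%N -> (b < 2)%N ->
        a%:Z + 2 * x = b%:Z + 2 * y -> a = b by move=> /(h _ _ _ _ ci ci') /val_inj.
    by move=> a b x y; lia.
  by congr pair => //; apply/rowP => i; have := ei i; rewrite cc => /addrI /mulfI ->.
rewrite -(@esum_esum R _ _ [set c | c \in C] (fun=> setT)
   (fun c z => (expR (- pi * tau * sqnorm (v (c, z))))%:E)); last first.
  by move=> c z _ _; rewrite lee_fin expR_ge0.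
rewrite esum_vspace; last by move=> c; apply: esum_ge0 => z _; rewrite lee_fin expR_ge0.
rewrite /weight_enum -sumEFin; apply: eq_bigr => c _.
pose S i : R := if c 0 i == 0 then theta3 (2 * tau) else theta2 (2 * tau).
pose s i : R := if c 0 i == 0 then 0 else 2^-1.
transitivity (\prod_i S i)%:E; last first.
  congr EFin; rewrite (bigID (fun i => c 0 i == 0)) /=; congr (_ * _).
    under eq_bigr => i ci do rewrite /S ci.
    rewrite prodr_const; congr (_ ^+ _).
    rewrite /hamming_weight -[X in (X - _)%N](card_ord n).
    rewrite -(cardsC [set i : 'I_n | c 0 i != 0]%SET) addKn.
    by apply: eq_card => i; rewrite !inE negbK.
  under eq_bigr => i ci do rewrite /S (negbTE ci).
  rewrite prodr_const; congr (_ ^+ _).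
  by apply: eq_card => i; rewrite !inE.
rewrite -(@esum_rV_prod R n (fun i => gauss_term (s i) (2 * tau))); last 2 first.
- by move=> i x; exact: gauss_term_ge0.
- by move=> i; rewrite /s /S; case: ifP.
apply: eq_esum => z _; congr EFin; rewrite -expR_sum; congr expR.
rewrite /sqnorm mulr_sumr; apply: eq_bigr => i _.
rewrite /v !mxE exprMn exprVn sqr_sqrtr // /s.
case: (F2_cases (c 0 i)) => -> /=; first by field.
by have -> : (1 %% (Zp_trunc (pdiv 2)).+2 = 1)%N by []; field.
Qed.

Lemma weight_enum_scale (R : realType) (n : nat) (C : {vspace 'rV['F_2]_n}) (z x y : R) :
  weight_enum C (z * x) (z * y) = z ^+ n * weight_enum C x y.
Proof.
rewrite /weight_enum mulr_sumr; apply: eq_bigr => c _.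
have wn : (hamming_weight c <= n)%N by rewrite -[leqRHS](card_ord n) max_card.
have -> : z ^+ n = z ^+ (n - hamming_weight c) * z ^+ hamming_weight c.
  by rewrite -exprD subnK.
by rewrite !exprMn; ring.
Qed.

(** The pair of arguments of the weight enumerator is proportional to
    [(sqrt (1 + t), sqrt (1 - t))], with factor [theta3 tau / sqrt 2]. *)
Lemma theta_ratio_constructionA (R : realType) (n k : nat) (C : {vspace 'rV['F_2]_n})
    (tau : R) : n = (2 * k)%N -> 0 < tau ->
  theta_ratio (constructionA R C) tau = f_code R C (theta_modulus tau) / 2 ^+ k.
Proof.
move=> nk tau0; rewrite /theta_ratio theta_series_constructionA //.
rewrite theta_series_int_lattice // /=.
have tau2 : 0 < 2 * tau by rewrite mulr_gt0.
have p0 := theta3_gt0 tau0; have p2 := theta3_gt0 tau2; have b2 := theta2_gt0 tau2.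
have sq (x : R) : 0 < x -> Num.sqrt (2 * (x / theta3 tau) ^+ 2) =
    Num.sqrt 2 / theta3 tau * x.
  move=> x0; rewrite sqrtrM // sqrtr_sqr ger0_norm ?divr_ge0 ?(ltW x0) ?(ltW p0) //.
  by rewrite mulrA mulrAC.
rewrite /f_code theta_modulusD1 // theta_modulusB1 // !sq // weight_enum_scale.
have -> : (Num.sqrt 2 / theta3 tau) ^+ n = 2 ^+ k / theta3 tau ^+ n.
  by rewrite expr_div_n; congr (_ / _); rewrite nk exprM sqr_sqrtr.
field.
by rewrite !expf_neq0 //= gt_eqF.
Qed.

(** * Words of small weight in a self-dual code *)

Lemma F2_neq0 (b : 'F_2) : b != 0 -> b = 1.
Proof. by case: (F2_cases b) => -> //; rewrite eqxx. Qed.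

Definition supp (n : nat) (c : 'rV['F_2]_n) : {set 'I_n} := [set i | c 0 i != 0]%SET.

Lemma supp_inj (n : nat) : injective (@supp n).
Proof.
move=> c d e; apply/rowP => i; have := congr1 (fun A : {set 'I_n} => i \in A) e.
rewrite !inE; case: eqP => [->|/eqP/F2_neq0 ->]; case: eqP => [->|/eqP/F2_neq0 ->] //.
Qed.

Lemma dotF2 (n : nat) (c d : 'rV['F_2]_n) :
  \sum_(i < n) c 0 i * d 0 i = #|supp c :&: supp d|%:R.
Proof.
rewrite -sum1_card natr_sum [RHS]big_mkcond /=; apply: eq_bigr => i _.
rewrite !inE; case: eqP => [->|/eqP/F2_neq0 ->]; first by rewrite mul0r.
by case: eqP => [->|/eqP/F2_neq0 ->]; rewrite mul1r.
Qed.

Section self_dual_codes.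
Variables (n : nat) (C : {vspace 'rV['F_2]_n}).
Hypothesis hsd : self_dual C.

Lemma supp_meet_even (c d : 'rV['F_2]_n) : c \in C -> d \in C ->
  (2 %| #|supp c :&: supp d|)%N.
Proof.
move=> cC dC; have : dual_code C d by rewrite -hsd.
move=> /(_ c cC); rewrite dotF2 => /eqP.
by rewrite -(dvdn_pcharf (pchar_Fp (isT : prime 2))).
Qed.

Lemma weight_even (c : 'rV['F_2]_n) : c \in C -> (2 %| hamming_weight c)%N.
Proof. by move=> cC; have := supp_meet_even cC cC; rewrite finset.setIid. Qed.

(** Two supports of size 2 meet in an even number of points, so they are equal
    or disjoint; and a word is determined by its support. *)
Lemma card_weight2 :
  (2 * #|[set c : 'rV['F_2]_n | (c \in C) && (hamming_weight c == 2)]%SET| <= n)%N.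
Proof.
set W := [set c | _]%SET.
have tr : finset.trivIset (@supp n @: W).
  apply/finset.trivIsetP => A B /imsetP[c cW ->] /imsetP[d dW ->] ne.
  move: cW dW; rewrite !inE => /andP[cC /eqP wc] /andP[dC /eqP wd].
  rewrite -finset.setI_eq0 -cards_eq0.
  have := supp_meet_even cC dC.
  have lec : (#|supp c :&: supp d| <= #|supp c|)%N by rewrite subset_leq_card ?finset.subsetIl.
  case e : #|supp c :&: supp d| => [|[|[|m]]] // _.
    case/negP: ne; apply/eqP.
    have ec : supp c :&: supp d = supp c.
      by apply/eqP; rewrite eqEcard finset.subsetIl /= e -[#|supp c|]/(hamming_weight c) wc.
    have ed : supp c :&: supp d = supp d.
      by apply/eqP; rewrite eqEcard finset.subsetIr /= e -[#|supp d|]/(hamming_weight d) wd.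
    by rewrite -ec ed.
  by rewrite e -[#|supp c|]/(hamming_weight c) wc in lec.
move: tr; rewrite /finset.trivIset big_imset /=; last by move=> c d _ _; exact: supp_inj.
rewrite (eq_bigr (fun=> 2)); last first.
  by move=> c; rewrite inE => /andP[_ /eqP].
rewrite sum_nat_const mulnC => /eqP ->.
by rewrite -[leqRHS](card_ord n) max_card.
Qed.

End self_dual_codes.

Lemma two_term_binomial (R : realType) (k : nat) (y s : R) : 0 <= y -> 0 <= s ->
  y ^+ k + k%:R * (y ^+ k.-1 * s) <= (y + s) ^+ k.
Proof.
move=> y0 s0; elim: k => [|k IH]; first by rewrite !expr0 mul0r addr0.
rewrite [in leRHS]exprSr; apply: (@le_trans _ _ ((y ^+ k + k%:R * (y ^+ k.-1 * s)) * (y + s))); last first.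
  by rewrite ler_wpM2r // addr_ge0.
case: k IH => [|k] _; first by rewrite !expr0 !expr1 mul0r addr0 !mul1r.
rewrite /= -subr_ge0.
have -> : (y ^+ k.+1 + k.+1%:R * (y ^+ k * s)) * (y + s) -
   (y ^+ k.+2 + k.+2%:R * (y ^+ k.+1 * s)) = k.+1%:R * (y ^+ k * s ^+ 2).
  by rewrite !exprS -!natr1; ring.
by rewrite mulr_ge0 // mulr_ge0 ?exprn_ge0.
Qed.

(** The words of weight 0 and 2 contribute at most the first two terms of the
    binomial expansion of [((2 - s) + s) ^+ k], because there are at most [k]
    words of weight 2; every other word has weight at least 4, as odd weights
    do not occur, and contributes [O (s ^+ 2)]. *)
Lemma f_code_upper (R : realType) (n k : nat) (C : {vspace 'rV['F_2]_n}) (s : R) :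
  n = (2 * k)%N -> self_dual C -> 0 <= s <= 1 ->
  f_code R C (1 - s) <= 2 ^+ k + (2 ^+ k * #|'rV['F_2]_n|%:R) * s ^+ 2.
Proof.
move=> nk hsd /andP[s0 s1]; rewrite /f_code /weight_enum.
have -> : 1 + (1 - s) = 2 - s by ring.
have -> : 1 - (1 - s) = s by ring.
have y0 : 0 <= 2 - s by lra.
pose w (c : 'rV['F_2]_n) := hamming_weight c.
pose T (c : 'rV['F_2]_n) : R := (2 - s) ^+ k *+ (w c == 0) +
   (2 - s) ^+ k.-1 * s *+ (w c == 2%N) + 2 ^+ k * s ^+ 2.
have termT c : c \in C ->
    Num.sqrt (2 - s) ^+ (n - w c) * Num.sqrt s ^+ w c <= T c.
  move=> cC; have /dvdnP[v wv] := weight_even hsd cC.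
  have wn : (w c <= n)%N by rewrite -[leqRHS](card_ord n) max_card.
  have -> : (n - w c = 2 * (k - v))%N by rewrite nk /w wv; lia.
  rewrite /T /w wv [(v * 2)%N]mulnC !exprM !sqr_sqrtr //.
  case: v wv => [|[|v]] wv.
  - rewrite subn0 expr0 mulr1 /= mulr1n mulr0n addr0 lerDl.
    by rewrite mulr_ge0 ?exprn_ge0.
  - rewrite subn1 expr1 /= mulr0n mulr1n add0r lerDl.
    by rewrite mulr_ge0 ?exprn_ge0.
  - rewrite mulnC /= !mulr0n !add0r.
    apply: ler_pM; rewrite ?exprn_ge0 //.
      apply: (@le_trans _ _ (2 ^+ (k - v.+2))); first by rewrite lerXn2r ?nnegrE //; lra.
      by rewrite ler_weXn2l ?leq_subr // ler1n.
    by rewrite ler_wiXn2l.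
apply: (le_trans (ler_sum _ termT)).
rewrite /T !big_split /=.
have N0 : \sum_(c | c \in C) (2 - s) ^+ k *+ (w c == 0) = (2 - s) ^+ k.
  rewrite (bigD1 (0 : 'rV['F_2]_n)) ?mem0v //= big1 ?addr0.
    have -> : w 0 = 0%N by apply/eqP; rewrite cards_eq0; apply/eqP/finset.setP => i; rewrite !inE mxE eqxx.
    by rewrite mulr1n.
  move=> c /andP[_ c0]; case: eqP => // /eqP; rewrite cards_eq0 => /eqP e.
  by case/negP: c0; apply/eqP; apply: supp_inj; rewrite /supp e; apply/finset.setP => i; rewrite !inE mxE eqxx.
have N2 : \sum_(c | c \in C) (2 - s) ^+ k.-1 * s *+ (w c == 2%N) <=
   k%:R * ((2 - s) ^+ k.-1 * s).
  have -> : \sum_(c | c \in C) (2 - s) ^+ k.-1 * s *+ (w c == 2%N) =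
     #|[set c : 'rV['F_2]_n | (c \in C) && (w c == 2%N)]%SET|%:R * ((2 - s) ^+ k.-1 * s).
    under eq_bigr do rewrite mulrb.
    by rewrite -big_mkcondr sumr_const mulr_natl; congr (_ *+ _); apply: eq_card => c; rewrite !inE.
  rewrite ler_wpM2r ?mulr_ge0 ?exprn_ge0 // ler_nat.
  have := card_weight2 hsd; rewrite [X in (_ <= X)%N -> _]nk leq_pmul2l //.
have N3 : \sum_(c | c \in C) 2 ^+ k * s ^+ 2 <= 2 ^+ k * #|'rV['F_2]_n|%:R * s ^+ 2.
  rewrite sumr_const -[leLHS]mulr_natr mulrAC ler_wpM2r ?exprn_ge0 //.
  by rewrite ler_wpM2l ?exprn_ge0 // ler_nat max_card.
rewrite N0; apply: lerD N3; apply: (le_trans (lerD (lexx _) N2)).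
apply: (le_trans (two_term_binomial _ y0 s0)).
by rewrite subrK.
Qed.

(** If [b] were negative, [f_code] would exceed [2 ^+ k] near [t = 1] by an
    amount linear in [1 - t], against [f_code_upper]. *)
Lemma linear_coef_ge0 (R : realType) (n k : nat) (C : {vspace 'rV['F_2]_n}) (b : R) :
  n = (2 * k)%N -> self_dual C ->
  (forall t : R, 0 <= t <= 1 -> f_code R C t = 2 ^+ k * (1 + b * (h_poly t - 1))) ->
  0 <= b.
Proof.
move=> nk hsd hf; rewrite leNgt; apply/negP => b0.
pose M : R := #|'rV['F_2]_n|%:R.
have M0 : 0 <= M by [].
(* Small enough for the error M s^2 to stay below the linear excess, which is
   at least - b s / 4 on ]0, 1/2]. *)
pose s : R := Num.min 2^-1 (- b / (8 * (M + 1))).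
have s0 : 0 < s.
  by rewrite lt_min invr_gt0 ltr0n /= divr_gt0 ?oppr_gt0 // mulr_gt0 // ltr_wpDl.
have s1 : s <= 2^-1 by rewrite ge_min lexx.
have sM : s * (8 * (M + 1)) <= - b.
  by rewrite -ler_pdivlMr ?mulr_gt0 ?ltr_wpDl // ge_min lexx orbT.
have sr : 0 <= s <= 1 by rewrite ltW //=; lra.
have := f_code_upper nk hsd sr; rewrite hf; last by lra.
have -> : 2 ^+ k + 2 ^+ k * #|'rV['F_2]_n|%:R * s ^+ 2 = 2 ^+ k * (1 + M * s ^+ 2) by rewrite /M; ring.
rewrite ler_pM2l ?exprn_gt0 // lerD2l.
have -> : h_poly (1 - s) - 1 = - (s * ((1 - s) ^+ 2 * (2 - s))) by rewrite /h_poly; ring.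
rewrite mulrN -mulNr mulrCA expr2 [M * _]mulrCA ler_pM2l // => h.
have q : 4^-1 <= (1 - s) ^+ 2 * (2 - s) by nra.
have : - b * 4^-1 <= M * s by apply: le_trans h; rewrite ler_wpM2l // oppr_ge0 ltW.
nra.
Qed.

(** * The polynomial of the coefficients and U-shapes *)

(** By Gleason's theorem on the weight enumerators of self-dual codes, [f_code]
    is [2 ^+ k] times such a polynomial in [h_poly]. *)
Definition gleason_poly (R : realType) (l : nat) (a : nat -> rat) : {poly R} :=
  \poly_(r < l.+1) ratr (a r).

Lemma horner_gleason (R : realType) (l : nat) (a : nat -> rat) (u : R) :
  (gleason_poly R l a).[u] = \sum_(0 <= r < l.+1) ratr (a r) * u ^+ r.
Proof. by rewrite horner_poly big_mkord. Qed.

(** For [u = 3 / 4] and [u = 1] the right-hand side is the image of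
    [alpha_coef l a j] and of [beta_coef l a j]. *)
Lemma horner_derivn_gleason (R : realType) (l : nat) (a : nat -> rat) (j : nat) (u : rat) :
  (j <= l)%N ->
  (gleason_poly R l a)^`(j).[ratr u] =
  ratr (\sum_(j <= r < l.+1) r`!%:R / (r - j)`!%:R * a r * u ^+ (r - j)).
Proof.
move=> jl.
rewrite (@horner_coef_wide _ (l.+1 - j)); last first.
  apply/leq_sizeP => i li; rewrite coef_derivn coef_poly ifF ?mul0rn //.
  by apply/negbTE; rewrite -leqNgt; lia.
rewrite rmorph_sum /= -[X in \sum_(X <= _ < _) _]add0n big_addn big_mkord.
apply: eq_bigr => i _; rewrite coef_derivn coef_poly ifT; last by have := ltn_ord i; lia.
rewrite addnK !rmorphM /= fmorphV !ratr_nat rmorphXn /= [(i + j)%N]addnC; congr (_ * _).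
rewrite -[LHS]mulr_natl; congr (_ * _).
have fne : i`!%:R != 0 :> R by rewrite pnatr_eq0 -lt0n fact_gt0.
rewrite ratr_nat; apply: (mulIf fne); rewrite mulfVK // -natrM; congr _%:R.
by have := @ffact_fact (j + i) j; rewrite addKn; apply; lia.
Qed.

Lemma affine_gt0 (R : realType) (q : {poly R}) (x y u : R) : (size q <= 2)%N ->
  0 < q.[x] -> 0 < q.[y] -> x <= u <= y -> 0 < q.[u].
Proof.
move=> sq; rewrite !(horner_coef_wide _ sq) !big_ord_recl !big_ord0 /= !expr0 !expr1 => hx hy /andP[xu uy].
rewrite !addr0 !mulr1 in hx hy *.
by case: (leP 0 q`_1) => h; nra.
Qed.

Section coefficient_conditions.
Variables (R : realType) (l : nat) (a : nat -> rat).
Hypothesis hmin : forall j : nat, (1 <= j <= l - 1)%N ->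
  0 < Num.min (alpha_coef l a j) (beta_coef l a j).

Local Notation P := (gleason_poly R l a).

Lemma derivn_ends (j : nat) : (1 <= j <= l - 1)%N ->
  0 < P^`(j).[3 / 4] /\ 0 < P^`(j).[1].
Proof.
move=> jl; have := hmin jl; rewrite lt_min => /andP[ha hb].
have jl' : (j <= l)%N by lia.
split.
  have -> : 3 / 4 = ratr (3 / 4) :> R by rewrite rmorphM fmorphV !rmorph_nat.
  by rewrite horner_derivn_gleason // ltr0q.
rewrite -[1](rmorph1 (@ratr R)) horner_derivn_gleason // ltr0q.
move: hb; rewrite /beta_coef; congr (_ < _).
by apply: eq_bigr => r _; rewrite expr1n mulr1.
Qed.

(** Downward induction on [j], starting from the affine derivative of order
    [l - 1]; below it, a derivative increases from a positive value at 3/4. *)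
Lemma derivn_gt0 (j : nat) (u : R) : (1 <= j <= l - 1)%N -> 3 / 4 <= u <= 1 ->
  0 < P^`(j).[u].
Proof.
move=> jl; have [i ji] : exists i, (j + i = l - 1)%N by exists (l - 1 - j)%N; lia.
elim: i j u jl ji => [|i IH] j u jl ji hu.
  have [h1 h2] := derivn_ends jl.
  apply: (@affine_gt0 R _ (3 / 4) 1) => //.
  apply/leq_sizeP => i li; rewrite coef_derivn coef_poly ifF ?mul0rn //.
  by apply/negbTE; rewrite -leqNgt; lia.
have [h1 _] := derivn_ends jl.
have /andP[] := hu; rewrite le_eqVlt => /predU1P[<- //|u1 u2].
have [c] := poly_mvt P^`(j) u1; rewrite in_itv /= => /andP[c1 c2].
rewrite -derivnS => /eqP; rewrite subr_eq => /eqP ->.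
rewrite ltr_wpDl // mulr_ge0 ?subr_ge0 ?(ltW u1) // ltW // IH //; try lia.
by rewrite (ltW c1) (le_trans (ltW c2)).
Qed.

End coefficient_conditions.

Lemma deriv_gleason1 (R : realType) (a : nat -> rat) :
  (gleason_poly R 1 a)^`() = (ratr (a 1%N))%:P.
Proof.
apply/polyP => i; rewrite coef_deriv coef_poly coefC.
by case: i => [|i] //; rewrite /= mul0rn.
Qed.

(** By the factor theorem the difference quotient of a polynomial extends to
    a polynomial, hence continuously, so that its limit relative to the segment
    is the ordinary one. *)
Lemma has_derivative_on_horner (R : realType) (a b : R) (f : R -> R) (G : {poly R}) (t : R) :
  (forall s, a <= s <= b -> f s = G.[s]) -> a <= t <= b ->
  has_derivative_on a b f t G^`().[t].
Proof.
move=> fG tab; rewrite /has_derivative_on.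
have /factor_theorem[Q GQ] : root (G - G.[t]%:P) t by rewrite rootE !hornerE subrr.
have GE : G = Q * ('X - t%:P) + G.[t]%:P by rewrite -GQ subrK.
have Qt : G^`().[t] = Q.[t].
  by rewrite GE derivD derivM derivXsubC derivC !hornerE subrr mulr0 add0r.
rewrite Qt.
have Qc : Q.[s] @[s --> within `[a, b] t^'] --> Q.[t].
  have : Q.[s] @[s --> t] --> Q.[t] by exact: continuous_horner.
  apply: cvg_trans; apply: cvg_app; apply: cvg_trans (cvg_within _) _.
  exact: cvg_within.
apply: cvg_trans Qc; apply: near_eq_cvg.
rewrite near_withinE; near=> s => /=; rewrite in_itv /= => sab.
have st : s != t by near: s; exact: nbhs_dnbhs_neq.
rewrite !fG // GE !hornerE subrr mulr0 add0r addrK mulfK // subr_eq0 //.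
Unshelve. all: by end_near. Qed.

Lemma h_polyE (R : realType) (t : R) : h_poly t = (t ^+ 2 - 2^-1) ^+ 2 + 3 / 4.
Proof. by rewrite /h_poly; field. Qed.

Lemma h_poly_range (R : realType) (t : R) : 0 <= t <= 1 -> 3 / 4 <= h_poly t <= 1.
Proof.
move=> /andP[t0 t1]; apply/andP; split; first by rewrite h_polyE lerDr sqr_ge0.
have -> : h_poly t = 1 - t ^+ 2 * (1 - t ^+ 2) by rewrite /h_poly; ring.
by rewrite gerBl mulr_ge0 ?sqr_ge0 // subr_ge0 expr_le1.
Qed.

(** * The minimum of the theta series ratio *)

Theorem corollary2 (R : realType) (n k l : nat) (C : {vspace 'rV['F_2]_n})
    (a : nat -> rat)
    (hn : (8 <= n)%N)
    (hk : n = (2 * k)%N)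
    (hl : l = (n %/ 8)%N)
    (hC : is_code k C)
    (hsd : self_dual C)
    (ha1 : \sum_(0 <= r < l.+1) a r = 1)
    (haf : forall t : R, 0 <= t <= 1 ->
       f_code R C t = 2 ^+ k * \sum_(0 <= r < l.+1) ratr (a r) * h_poly t ^+ r)
    (hmin : forall j : nat, (1 <= j <= l - 1)%N ->
       0 < Num.min (alpha_coef l a j) (beta_coef l a j)) :
  [/\ ((l = 1%N -> a 1%N != 0) ->
        U_shaped (f_code R C) 0 1 (1 / Num.sqrt 2)),
      (forall tau : R, 0 < tau -> theta_ratio (constructionA R C) tau <= 1),
      (forall tau : R, 0 < tau ->
         (theta_series (constructionA R C) tau <=
          theta_series (int_lattice R n) tau)%E),
      argmin_pos (theta_ratio (constructionA R C)) 1 &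
      ((l = 1%N -> a 1%N != 0) ->
        argmin_pos (theta_ratio (constructionA R C)) = [set 1])].
Proof.
pose P := gleason_poly R l a.
have fP t : 0 <= t <= 1 -> f_code R C t = 2 ^+ k * P.[h_poly t].
  by move=> t01; rewrite haf // horner_gleason.
have l1 : (1 <= l)%N by rewrite hl divn_gt0.
have P1 : P.[1] = 1.
  rewrite horner_gleason -[RHS](rmorph1 (@ratr R)) -ha1 rmorph_sum.
  by apply: eq_bigr => r _; rewrite expr1n mulr1.
have dP u : 3 / 4 <= u <= 1 ->
    0 <= P^`().[u] /\ ((l = 1%N -> a 1%N != 0) -> 0 < P^`().[u]).
  move=> hu; have [l2|l2] : l = 1%N \/ (1 < l)%N by lia.
    (* With l = 1, the normalization a_0 + a_1 = 1 makes P u = 1 + a_1 (u - 1). *)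
    have a10 : 0 <= ratr (a 1%N) :> R.
      apply: (linear_coef_ge0 hk hsd) => t t01; rewrite haf // l2.
      have := ha1; rewrite l2 !big_nat_recr //= big_geq // add0r => /(congr1 (@ratr R)).
      rewrite rmorphD rmorph1 /= => e; congr (_ * _).
      have -> : ratr (a 0%N) = 1 - ratr (a 1%N) :> R by rewrite -e addrK.
      by rewrite big_geq // add0r; ring.
    rewrite /P l2 deriv_gleason1 hornerC; split => // /(_ erefl) a1.
    by rewrite lt_neqAle a10 andbT eq_sym fmorph_eq0.
  have h : 0 < P^`().[u].
    by rewrite -derivn1; apply: (derivn_gt0 hmin) => //; lia.
  by split => //; exact: ltW.
have Pmono x y : 3 / 4 <= x -> x <= y -> y <= 1 -> P.[x] <= P.[y].
  move=> x0; rewrite le_eqVlt => /predU1P[-> //|xy] y1.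
  have [c] := poly_mvt P xy; rewrite in_itv /= => /andP[c1 c2] e.
  rewrite -subr_ge0 e mulr_ge0 ?subr_ge0 ?(ltW xy) //.
  have cr : 3 / 4 <= c <= 1 by apply/andP; split; lra.
  by have [] := dP _ cr.
have Pstrict y : (l = 1%N -> a 1%N != 0) -> 3 / 4 < y <= 1 -> P.[3 / 4] < P.[y].
  move=> hl1 /andP[xy y1].
  have [c] := poly_mvt P xy; rewrite in_itv /= => /andP[c1 c2] e.
  rewrite -subr_gt0 e mulr_gt0 ?subr_gt0 //.
  have cr : 3 / 4 <= c <= 1 by apply/andP; split; lra.
  by have [_ pos] := dP _ cr; exact: pos.
have ratioP tau : 0 < tau ->
    theta_ratio (constructionA R C) tau = P.[h_poly (theta_modulus tau)].
  move=> tau0; rewrite (theta_ratio_constructionA _ hk) // fP ?theta_modulus_range //.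
  by rewrite mulrAC mulfV ?mul1r // expf_neq0.
have h_range tau : 0 < tau -> 3 / 4 <= h_poly (theta_modulus tau : R) <= 1.
  by move=> tau0; exact/h_poly_range/theta_modulus_range.
have ratio_le1 tau : 0 < tau -> theta_ratio (constructionA R C) tau <= 1.
  by move=> tau0; rewrite ratioP // -P1; have /andP[h1 h2] := h_range _ tau0; exact: Pmono.
have h1E : h_poly (theta_modulus 1) = 3 / 4 :> R.
  have e : theta_modulus 1 ^+ 2 = 2^-1 :> R by apply/eqP; rewrite theta_modulus_half.
  by rewrite h_polyE e subrr expr0n add0r.
have min1 : argmin_pos (theta_ratio (constructionA R C)) 1.
  split => // s s0; rewrite !ratioP // h1E.
  by have /andP[h1 h2] := h_range _ s0; exact: Pmono.
split => //.
- move=> hl1.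
  have s2 : 0 < Num.sqrt 2 :> R by rewrite sqrtr_gt0.
  have t02 : (1 / Num.sqrt 2) ^+ 2 = 2^-1 :> R by rewrite mul1r exprVn sqr_sqrtr.
  have t0pos : 0 < 1 / Num.sqrt 2 :> R by rewrite divr_gt0.
  have t0le1 : 1 / Num.sqrt 2 <= 1 :> R by nra.
  split; first by rewrite in_itv /= (ltW t0pos).
  pose H : {poly R} := 'X^4 - 'X^2 + 1.
  have HE t : H.[t] = h_poly t by rewrite /H !hornerE.
  pose G := (2 ^+ k) *: (P \Po H).
  have GE t : G^`().[t] = 2 ^+ k * (P^`().[h_poly t] * (2 * t * (2 * t ^+ 2 - 1))).
    rewrite /G derivZ deriv_comp hornerZ hornerM horner_comp HE; congr (_ * (_ * _)).
    by rewrite /H derivD derivB !derivXn derivC addr0 hornerD hornerN !hornerMn !hornerXn; ring.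
  exists (fun t => G^`().[t]); split.
  + move=> t; rewrite in_itv /= => t01; apply: has_derivative_on_horner => // s s01.
    by rewrite fP // /G hornerZ horner_comp HE.
  + move=> t /andP[t0 t1]; rewrite GE.
    have tr : 0 <= t <= 1 by apply/andP; split; lra.
    have [_ /(_ hl1) pos] := dP _ (h_poly_range tr).
    have t2 : t ^+ 2 < 2^-1 by rewrite -t02 ltr_pXn2r ?nnegrE ?(ltW t0) ?(ltW t0pos).
    by rewrite !pmulr_rlt0 ?exprn_gt0 ?pos ?mulr_gt0 //; lra.
  + by rewrite GE t02; field.
  + move=> t /andP[t0 t1]; rewrite GE.
    have tpos : 0 < t by exact: lt_trans t0.
    have tr : 0 <= t <= 1 by apply/andP; split; lra.
    have [_ /(_ hl1) pos] := dP _ (h_poly_range tr).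
    have t2 : 2^-1 < t ^+ 2 by rewrite -t02 ltr_pXn2r ?nnegrE ?(ltW tpos) ?(ltW t0pos).
    by rewrite !pmulr_rgt0 ?exprn_gt0 ?pos //; lra.
- move=> tau tau0; have := ratio_le1 _ tau0; rewrite /theta_ratio.
  rewrite theta_series_constructionA // theta_series_int_lattice //= lee_fin.
  by rewrite ler_pdivrMr ?mul1r // exprn_gt0 // theta3_gt0.
- move=> hl1; apply/seteqP; split => [tau [tau0 hmin_tau]|_ -> //].
  apply/eqP; rewrite -theta_modulus_half //.
  have := hmin_tau 1 ltr01; rewrite !ratioP // h1E leNgt => /negP hlt.
  apply/negPn/negP => ne; apply: hlt; apply: Pstrict => //.
  have /andP[_ ->] := h_range _ tau0; rewrite andbT h_polyE ltrDr.
  by rewrite lt_neqAle sqr_ge0 andbT eq_sym sqrf_eq0 subr_eq0.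
Qed.
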